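(* For $n\ge2$ let $W^h_n\colon\mathcal{C}_n\to \mathrm{Inv}(sl_2^{\otimes n})$ be the restriction of the $sl_2$ weight system to the space $\mathcal{C}_n$ of connected trees with $n$ univalent vertices labeled by distinct elements of $\{1,\ldots,n\}$; it is a homomorphism of $\mathfrak{S}_n$-modules. Write $\chi_M$ for the character of an $\mathfrak{S}_n$-module $M$. (i) For $n=2$ or $n>2$ odd, $$\chi_{\ker(W^h_n)}=\chi_{\mathcal{C}_n}-\chi_{\mathrm{Inv}(sl_2^{\otimes n})}\quad\text{and}\quad \chi_{\mathrm{Im}(W^h_n)}=\chi_{\mathrm{Inv}(sl_2^{\otimes n})}.$$ (ii) For $n\ge4$ even, $$\chi_{\ker(W^h_n)}=\chi_{\mathcal{C}_n}-\chi_{\mathrm{Inv}(sl_2^{\otimes n})}+\chi_U\quad\text{and}\quad \chi_{\mathrm{Im}(W^h_n)}=\chi_{\mathrm{Inv}(sl_2^{\otimes n})}-\chi_U,$$ where $U$ is the trivial (one-dimensional) representation of $\mathfrak{S}_n$.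
   Context: The symmetric group $\mathfrak{S}_n$ acts on $\mathcal{C}_n$ by permuting the labels and on $\mathrm{Inv}(sl_2^{\otimes n})$ by permuting the tensor factors. The Lie algebra $sl_2$ over $\mathbb{Q}$ has basis $h,e,f$ with $[h,e]=2e$, $[h,f]=-2f$, $[e,f]=h$. $\mathrm{Inv}(sl_2^{\otimes n})$ is the space of tensors in the $n$-fold tensor power of the adjoint representation that are mapped to zero by $h,e,f$. A Jacobi diagram is a finite unitrivalent graph (vertices of valence 1 or 3), each trivalent vertex being equipped with a cyclic ordering of its three incident half-edges, and each connected component having at least one univalent vertex. A tree is a Jacobi diagram without cycles; a strut is a tree with a single edge. An internal edge is an edge connecting two trivalent vertices. $\mathcal{C}_n$ is the $\mathbb{Q}$-space spanned by connected trees with exactly $n$ univalent vertices, in which each of the labels $1,\ldots,n$ appears exactly once, modulo the AS relation (reversing the cyclic order at one trivalent vertex multiplies the diagram by $-1$) and the IHX relation (the diagrammatic Jacobi identity). Let $\kappa\colon sl_2\otimes sl_2\to\mathbb{Q}$ be the symmetric bilinear form with $\kappa(h,h)=2$, $\kappa(e,f)=1$, $\kappa(h,e)=\kappa(h,f)=\kappa(e,e)=\kappa(f,f)=0$; let $c=\frac12 h\otimes h+f\otimes e+e\otimes f$ and $b=h\otimes e\otimes f+e\otimes f\otimes h+f\otimes h\otimes e-h\otimes f\otimes e-f\otimes e\otimes h-e\otimes h\otimes f$. The map $W^h_n$ is the linear map defined on a connected tree $T$ as follows: for $n=2$ ($T$ a strut), $W^h_2(T)=c$. For $n\ge3$, attach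 a copy of $b$ to each trivalent vertex of $T$, its three tensor factors being associated to the three half-edges following the cyclic order, and contract by $\kappa$ the two factors on each internal edge; the result is a tensor with one factor for each univalent vertex, and $W^h_n(T)$ is this tensor with the factor of the $j$-labeled vertex put in position $j$. *)

(* Defs.v *)
From HB Require Import structures.
From mathcomp Require Import all_boot all_order all_algebra all_fingroup.

Set Implicit Arguments.
Unset Strict Implicit.
Unset Printing Implicit Defensive.

Import GroupScope GRing.Theory.
Local Open Scope ring_scope.

(** * Quotients of finite-dimensional spaces, and characters *)

(* The quotient V / R, carried by a complement of R.  Together with [quot_pi]
   it is characterised by [quot_pi_surj] and [lker_quot_pi]: the projection is
   onto and its kernel is exactly R. *)
Section Quotient.
Variables (K : fieldType) (V : vectType K).

Definition quot (R : {vspace V}) : vectType K := subvs_of (R^C)%VS.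

Variable R : {vspace V}.

Definition quot_pi : 'Hom(V, quot R) :=
  (linfun (vsproj (R^C)%VS) \o daddv_pi (R^C)%VS R)%VF.

(* The factorisation of f through V / R, meaningful when f kills R. *)
Definition quot_lift (W : vectType K) (f : 'Hom(V, W)) : 'Hom(quot R, W) :=
  (f \o linfun (@vsval _ _ (R^C)%VS))%VF.

Let capRC : ((R^C :&: R)%VS = 0%VS).
Proof. by rewrite capvC capv_compl. Qed.

Lemma quot_piE v : vsval (quot_pi v) = daddv_pi (R^C)%VS R v.
Proof. by rewrite comp_lfunE lfunE /= vsprojK ?memv_pi. Qed.

Lemma quot_pi_sub v : v - vsval (quot_pi v) \in R.
Proof.
have vCR : v \in (R^C + R)%VS by rewrite addvC addv_complf memvf.
have vE := daddv_pi_add capRC vCR.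
rewrite quot_piE; set u := daddv_pi (R^C)%VS R v in vE *.
by rewrite -vE [u + _]addrC addrK memv_pi.
Qed.

Lemma quot_pi_surj : limg quot_pi = fullv.
Proof.
apply/vspaceP=> x; rewrite memvf; apply/memv_imgP.
exists (vsval x); rewrite ?memvf //; apply: val_inj; rewrite /= quot_piE.
by rewrite daddv_pi_id // subvsP.
Qed.

Lemma lker_quot_pi : lker quot_pi = R.
Proof.
apply/vspaceP=> v; rewrite memv_ker; apply/eqP/idP => [v0|vR].
  have := quot_pi_sub v; rewrite v0.
  by have -> : vsval (0 : quot R) = 0 by []; rewrite subr0.
apply: val_inj; change (vsval (quot_pi v) = 0).
have uR : vsval (quot_pi v) \in R.
  have := rpredB vR (quot_pi_sub v).
  by rewrite opprB addrC subrK.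
by apply/eqP; rewrite -memv0 -capRC memv_cap uR subvsP.
Qed.

Lemma quot_liftE (W : vectType K) (f : 'Hom(V, W)) v :
  (R <= lker f)%VS -> quot_lift f (quot_pi v) = f v.
Proof.
move=> /subvP/(_ _ (quot_pi_sub v)); rewrite memv_ker linearB subr_eq0.
by move=> /eqP->; rewrite comp_lfunE; congr (f _); rewrite lfunE.
Qed.

End Quotient.

(* The character of the (sub)module U of V, where g acts on V by act g: the
   trace of the matrix of act g on U, for U stable under the action. *)
Definition chi (gT : finGroupType) (K : fieldType) (V : vectType K)
    (act : gT -> 'End(V)) (U : {vspace V}) (g : gT) : K :=
  \tr (\matrix_(i < \dim U, j < \dim U)
         coord (vbasis U) j (act g (vbasis U)`_i)).

Definition trivial_act (gT : finGroupType) (K : fieldType) (g : gT) :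
  'End(K^o) := \1%VF.

(** * Jacobi trees *)

(* A Jacobi diagram with n univalent vertices labeled by 'I_n and k trivalent
   vertices is given by its half-edges -- one for each univalent vertex, three
   for each trivalent vertex, in the cyclic order 0, 1, 2 -- and by the
   fixed-point free involution exchanging the two halves of each edge. *)
Notation half n k := ('I_n + 'I_k * 'I_3)%type.
Notation vert n k := ('I_n + 'I_k)%type.

Section Diagrams.
Variables n k : nat.
Implicit Types (d s : {perm half n k}) (h : half n k) (v w : vert n k).

Definition vtx h : vert n k :=
  match h with inl j => inl j | inr p => inr p.1 end.

(* The next half-edge in the cyclic order around the same vertex. *)
Definition next_half h : half n k :=
  match h with inl j => inl j | inr p => inr (p.1, ordS p.2) end.

Definition is_diagram d := [forall h, (d (d h) == h) && (d h != h)].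

Definition adj d v w := [exists h, (vtx h == v) && (vtx (d h) == w)].

Definition is_connected d := [forall v, forall w, connect (adj d) v w].

(* A cycle of the graph: a cyclic sequence of half-edges, leaving pairwise
   distinct vertices, each edge ending where the next one starts and different
   from the next one; this covers loops and multiple edges.  Its length is at
   most the number n + k of vertices. *)
Definition step d h h' := (vtx h' == vtx (d h)) && (h' != d h).

Definition is_cycle d (c : seq (half n k)) :=
  [&& c != [::], path.cycle (step d) c & uniq (map vtx c)].

Definition is_acyclic d :=
  [forall c : {bseq (n + k) of half n k}, ~~ is_cycle d c].

Definition is_tree d := [&& is_diagram d, is_connected d & is_acyclic d].

(* In the following, the permutation s of the half-edges transforms the diagram
   d into the diagram d ^ s, in which s h and s (d h) are joined for each h. *)

Definition is_iso s :=
  [forall j, s (inl j) == inl j] && [forall h, s (next_half h) == next_half (s h)].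

Definition iso_rel d d' := [exists s, is_iso s && (d' == d ^ s)%g].

Definition as_rel d d' :=
  [exists p : 'I_k * 'I_3, d' == (d ^ tperm (inr p) (next_half (inr p)))%g].

(* Let (x, a, b) and (y, c, z) be the half-edges at two trivalent vertices, in
   cyclic order, with x and y joined by an internal edge.  The three terms of
   the relation differ by a cyclic permutation of a, b, c: when A, B, C, Z are
   attached to a, b, c, z, these are [[A,B],C], [[C,A],B] and [[B,C],A] with
   root Z.  The permutation below maps a to b, b to c and c to a. *)
Definition ihx_perm (p q : 'I_k * 'I_3) : {perm half n k} :=
  let a := next_half (inr p) in let b := next_half a in let c := next_half (inr q) in
  (tperm a b * tperm a c)%g.

Definition ihx_rel d d' d'' :=
  [exists p, exists q, [&& d (inr p) == inr q,
     d' == (d ^ ihx_perm p q)%g & d'' == (d' ^ ihx_perm p q)%g]].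

Definition label_fun (s : 'S_n) h : half n k :=
  match h with inl j => inl (s j) | inr p => inr p end.

Lemma label_fun_inj (s : 'S_n) : injective (label_fun s).
Proof. by move=> [i|p] [j|q] //= [/perm_inj->]. Qed.

Definition label_perm (s : 'S_n) : {perm half n k} := perm (@label_fun_inj s).

End Diagrams.

Arguments vtx {n k} h.
Arguments next_half {n k} h.

(* A connected tree with n >= 2 univalent vertices has n - 2 trivalent ones. *)
Definition tree n := {d : {perm half n n.-2} | is_tree d}.

Section LabelAction.
Local Open Scope group_scope.
Variables n k : nat.
Implicit Types (d : {perm half n k}) (s t : 'S_n).

Lemma label_perm1 : label_perm k (1 : 'S_n) = 1.
Proof. by apply/permP => -[j|p]; rewrite permE /= !perm1. Qed.

Lemma label_permM s t : label_perm k (s * t) = label_perm k s * label_perm k t.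
Proof. by apply/permP => -[j|p]; rewrite !permE /= !permE. Qed.

Lemma label_permV s : label_perm k s^-1 = (label_perm k s)^-1.
Proof. by apply: (mulgI (label_perm k s)); rewrite -label_permM !mulgV label_perm1. Qed.

Definition label_vert s (v : vert n k) : vert n k :=
  match v with inl j => inl (s j) | inr p => inr p end.

Lemma label_vert_inj s : injective (label_vert s).
Proof. by move=> [i|p] [j|q] //= [/perm_inj->]. Qed.

Lemma vtx_label s h : vtx (label_perm k s h) = label_vert s (vtx h).
Proof. by case: h => [j|p]; rewrite permE. Qed.

Lemma is_tree_label d s : is_tree d -> is_tree (d ^ label_perm k s).
Proof.
set t := label_perm k s; case/and3P=> dP cP aP; apply/and3P; split.
- apply/forallP=> h; rewrite -[h](permKV t); move: (t^-1 h) => {}h.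
  by rewrite !permJ !(inj_eq perm_inj); apply: (forallP dP h).
- apply/forallP=> v; apply/forallP=> w.
  pose f := label_vert s^-1.
  have fK : cancel f (label_vert s) by case=> [j|p] //=; rewrite permKV.
  rewrite -(fK v) -(fK w).
  have /connectP[p pP ->] := forallP (forallP cP (f v)) (f w).
  apply/connectP; exists (map (label_vert s) p); last by rewrite last_map.
  rewrite path_map; apply: sub_path pP => x y /existsP[h /andP[/eqP <- /eqP <-]].
  by apply/existsP; exists (t h); rewrite permJ !vtx_label !eqxx.
- apply/forallP=> c; apply/negP=> /and3P[c0 cc cu].
  have sz : (size (map t^-1 c) <= n + k)%N by rewrite size_map size_bseq.
  have /negP[] := forallP aP (Bseq sz); apply/and3P; split.
  + by move: c0; rewrite -!size_eq0 size_map.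
  + rewrite cycle_map; apply: sub_cycle cc => x y /=.
    rewrite /step -{1 2}[x](permKV t) -{1 2}[y](permKV t) permJ !vtx_label.
    by rewrite (inj_eq (@label_vert_inj s)) (inj_eq perm_inj).
  + move: cu; have -> : map vtx c = map (label_vert s) (map vtx (map t^-1 c)).
      rewrite -!map_comp; apply: eq_map => h /=.
      by rewrite -vtx_label -/t permKV.
    exact: map_uniq.
Qed.

Lemma iso_rel_label d d' s :
  iso_rel d d' -> iso_rel (d ^ label_perm k s) (d' ^ label_perm k s).
Proof.
case/existsP=> g /andP[/andP[/forallP gl /forallP gr] /eqP ->].
apply/existsP; exists (g ^ label_perm k s); rewrite -!conjJg eqxx andbT.
have lr (u : 'S_n) h : next_half (label_perm k u h) = label_perm k u (next_half h).
  by case: h => [j|p]; rewrite !permE.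
apply/andP; split; apply/forallP.
  move=> j; have -> : inl j = label_perm k s (inl (s^-1 j)).
    by rewrite permE /= permKV.
  by rewrite permJ (eqP (gl _)).
move=> h; rewrite -[h](permKV (label_perm k s)) lr !permJ.
by rewrite (eqP (gr _)) lr.
Qed.

Lemma tperm_label s p q : tperm (inr p) (inr q) ^ label_perm k s =
  tperm (inr p) (inr q).
Proof. by rewrite tpermJ !permE. Qed.

Lemma as_rel_label d d' s :
  as_rel d d' -> as_rel (d ^ label_perm k s) (d' ^ label_perm k s).
Proof.
case/existsP=> p /eqP->; apply/existsP; exists p.
by rewrite -{2}(tperm_label s) -conjJg.
Qed.

Lemma ihx_rel_label d d' d'' s : ihx_rel d d' d'' ->
  ihx_rel (d ^ label_perm k s) (d' ^ label_perm k s) (d'' ^ label_perm k s).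
Proof.
case/existsP=> p /existsP[q /and3P[/eqP dpq /eqP-> /eqP->]].
apply/existsP; exists p; apply/existsP; exists q.
have e : ihx_perm n p q = ihx_perm n p q ^ label_perm k s.
  by rewrite conjMg !tperm_label.
apply/and3P; split; last 2 first.
- by rewrite {2}e -conjJg.
- by rewrite {4}e -conjJg.
have lr r : label_perm k s (inr r) = inr r by rewrite permE.
by rewrite -(lr p) permJ dpq lr.
Qed.

End LabelAction.

(* The label j is replaced by s j. *)
Definition relabel n (s : 'S_n) (T : tree n) : tree n :=
  exist (fun d => is_tree d) _ (is_tree_label s (valP T)).

(** * The space C_n *)

Notation free_tree n := {ffun tree n -> rat^o}.

Section TreeSpace.
Variable n : nat.
Implicit Types (s t : 'S_n) (T : tree n).


Definition delta T : free_tree n := [ffun T' => (T' == T)%:R].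

Definition free_ext (V : vectType rat) (f : tree n -> V) : 'Hom(free_tree n, V) :=
  linfun (fun x : free_tree n => \sum_T (x T : rat) *: f T).

Definition tree_rels : {vspace free_tree n} :=
  ( \sum_(p : tree n * tree n | iso_rel (val p.1) (val p.2))
       <[delta p.1 - delta p.2]>
  + \sum_(p : tree n * tree n | as_rel (val p.1) (val p.2))
       <[delta p.1 + delta p.2]>
  + \sum_(p : tree n * tree n * tree n
           | ihx_rel (val p.1.1) (val p.1.2) (val p.2))
       <[delta p.1.1 + delta p.1.2 + delta p.2]>)%VS.


Definition tree_class T : quot tree_rels := quot_pi tree_rels (delta T).

Definition Cn_act s : 'End(quot tree_rels) :=
  quot_lift tree_rels (free_ext (fun T => tree_class (relabel s T))).

Lemma free_extE (V : vectType rat) (f : tree n -> V) T :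
  free_ext f (delta T) = f T.
Proof.
have lin : linear (fun x : free_tree n => \sum_T (x T : rat) *: f T).
  move=> a x y; rewrite scaler_sumr -big_split /=; apply: eq_bigr => U _.
  by rewrite !ffunE scalerDl scalerA.
pose L := GRing.isLinear.Build _ _ _ _ _ lin.
pose g : {linear free_tree n -> V} := HB.pack (fun x : free_tree n => \sum_T (x T : rat) *: f T) L.
rewrite (lfunE g) /= (bigD1 T) //= ffunE eqxx scale1r big1 ?addr0 // => U.
by rewrite ffunE => /negPf ->; rewrite scale0r.
Qed.

Lemma free_treeE (y : free_tree n) : y = \sum_T (y T : rat) *: delta T.
Proof.
apply/ffunP=> T; rewrite sum_ffunE (bigD1 T) //=.
rewrite [X in _ = _ + X]big1 => [|U UT]; rewrite !ffunE.
  by rewrite eqxx addr0; apply/esym/(mulr1 (y T : rat)).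
by rewrite eq_sym (negPf UT); apply: (mulr0 (y U : rat)).
Qed.

Lemma tree_class_iso T T' :
  iso_rel (val T) (val T') -> tree_class T = tree_class T'.
Proof.
move=> e; apply/eqP; rewrite -subr_eq0 -linearB -memv_ker lker_quot_pi.
rewrite /tree_rels -addvA; apply: (subv_trans _ (addvSl _ _)).
exact: (sumv_sup (T, T')).
Qed.

Lemma tree_class_as T T' :
  as_rel (val T) (val T') -> tree_class T + tree_class T' = 0.
Proof.
move=> e; apply/eqP; rewrite -linearD -memv_ker lker_quot_pi.
rewrite /tree_rels; apply: (subv_trans _ (addvSl _ _)).
apply: (subv_trans _ (addvSr _ _)); exact: (sumv_sup (T, T')).
Qed.

Lemma tree_class_ihx T T' T'' : ihx_rel (val T) (val T') (val T'') ->
  tree_class T + tree_class T' + tree_class T'' = 0.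
Proof.
move=> e; apply/eqP; rewrite -!linearD -memv_ker lker_quot_pi.
rewrite /tree_rels; apply: (subv_trans _ (addvSr _ _)).
exact: (sumv_sup (T, T', T'')).
Qed.

(* The universal property of C_n. *)
Lemma tree_rels_ker (V : vectType rat) (f : tree n -> V) :
    (forall T T', iso_rel (val T) (val T') -> f T = f T') ->
    (forall T T', as_rel (val T) (val T') -> f T + f T' = 0) ->
    (forall T T' T'', ihx_rel (val T) (val T') (val T'') ->
       f T + f T' + f T'' = 0) ->
  (tree_rels <= lker (free_ext f))%VS.
Proof.
move=> fi fa fh; rewrite !subv_add -andbA; apply/and3P; split.
- apply/subv_sumP=> -[T T'] /= e.
  by rewrite -memvE memv_ker linearB /= !free_extE (fi _ _ e) subrr.
- apply/subv_sumP=> -[T T'] /= e.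
  by rewrite -memvE memv_ker linearD /= !free_extE (fa _ _ e).
- apply/subv_sumP=> -[[T T'] T''] /= e.
  by rewrite -memvE memv_ker !linearD /= !free_extE (fh _ _ _ e).
Qed.

Lemma Cn_act_class s T : Cn_act s (tree_class T) = tree_class (relabel s T).
Proof.
rewrite quot_liftE ?free_extE //; apply: tree_rels_ker.
- by move=> U U' e; apply: tree_class_iso; apply: iso_rel_label.
- by move=> U U' e; apply: tree_class_as; apply: as_rel_label.
- by move=> U U' U'' e; apply: tree_class_ihx; apply: ihx_rel_label.
Qed.

Lemma Cn_eq (V : vectType rat) (f g : 'Hom(quot tree_rels, V)) :
  (forall T, f (tree_class T) = g (tree_class T)) -> f = g.
Proof.
move=> e; apply/lfunP=> x; have := memvf x.
rewrite -quot_pi_surj => /memv_imgP[y _ ->].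
rewrite (free_treeE y) !linear_sum; apply: eq_bigr => T _.
rewrite !linearZ; congr (_ *: _); exact: e.
Qed.

Lemma Cn_act1 : Cn_act 1%g = \1%VF.
Proof.
apply: Cn_eq => T; rewrite Cn_act_class id_lfunE; congr tree_class.
by apply: val_inj; rewrite /= label_perm1 conjg1.
Qed.

Lemma Cn_actM s t : Cn_act (s * t)%g = (Cn_act t \o Cn_act s)%VF.
Proof.
apply: Cn_eq => T; rewrite [RHS]comp_lfunE.
have e := etrans (congr1 (Cn_act t) (Cn_act_class s T)) (Cn_act_class t _).
apply: etrans (esym e); apply: etrans (Cn_act_class _ _) _; congr tree_class.
by apply: val_inj; rewrite /= label_permM conjgM.
Qed.

End TreeSpace.

Notation Cn n := (quot (tree_rels n)).

(** * sl_2 and invariant tensors *)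

Inductive sl2_basis := sl_h | sl_e | sl_f.

Definition sl2_to (x : sl2_basis) : 'I_3 :=
  match x with sl_h => inord 0 | sl_e => inord 1 | sl_f => inord 2 end.
Definition sl2_of (i : 'I_3) : sl2_basis :=
  match val i with 0%N => sl_h | 1%N => sl_e | _ => sl_f end.
Lemma sl2_toK : cancel sl2_to sl2_of.
Proof. by case; rewrite /sl2_of /= inordK. Qed.
HB.instance Definition _ := Equality.copy sl2_basis (can_type sl2_toK).
HB.instance Definition _ := Choice.copy sl2_basis (can_type sl2_toK).
HB.instance Definition _ := Countable.copy sl2_basis (can_type sl2_toK).
HB.instance Definition _ := Finite.copy sl2_basis (can_type sl2_toK).

(* The coefficient of z in [x, y]. *)
Definition sl2_bracket (x y z : sl2_basis) : rat :=
  match x, y, z with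
  | sl_h, sl_e, sl_e => 2 | sl_e, sl_h, sl_e => -2
  | sl_h, sl_f, sl_f => -2 | sl_f, sl_h, sl_f => 2
  | sl_e, sl_f, sl_h => 1 | sl_f, sl_e, sl_h => -1
  | _, _, _ => 0
  end.

Definition kappa (x y : sl2_basis) : rat :=
  match x, y with
  | sl_h, sl_h => 2 | sl_e, sl_f => 1 | sl_f, sl_e => 1 | _, _ => 0
  end.

(* The coefficients of c and b. *)
Definition c_coef (x y : sl2_basis) : rat :=
  match x, y with
  | sl_h, sl_h => 2^-1 | sl_f, sl_e => 1 | sl_e, sl_f => 1 | _, _ => 0
  end.

Definition b_coef (x y z : sl2_basis) : rat :=
  match x, y, z with
  | sl_h, sl_e, sl_f => 1 | sl_e, sl_f, sl_h => 1 | sl_f, sl_h, sl_e => 1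
  | sl_h, sl_f, sl_e => -1 | sl_f, sl_e, sl_h => -1 | sl_e, sl_h, sl_f => -1
  | _, _, _ => 0
  end.

(* The n-fold tensor power of sl_2: t I is the coefficient in t of the tensor
   product of the basis vectors I 0, ..., I (n - 1). *)
Notation tens n := {ffun {ffun 'I_n -> sl2_basis} -> rat^o}.

Section Tensors.
Variable n : nat.
Implicit Types (s t : 'S_n) (I : {ffun 'I_n -> sl2_basis}).


Definition set_factor I (j : 'I_n) (y : sl2_basis) : {ffun 'I_n -> sl2_basis} :=
  [ffun i => if i == j then y else I i].

(* The basis vector x acts as the sum over j of ad x on the j-th factor. *)
Definition sl2_act_fun (x : sl2_basis) (t : tens n) : tens n :=
  [ffun I : {ffun 'I_n -> sl2_basis} =>
     \sum_(j < n) \sum_y sl2_bracket x y (I j) * t (set_factor I j y)].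

Definition sl2_act (x : sl2_basis) : 'End(tens n) := linfun (sl2_act_fun x).

Definition Inv : {vspace tens n} := (\bigcap_x lker (sl2_act x))%VS.

(* The factor in position j is moved to position s j. *)
Definition tens_act_fun s (t : tens n) : tens n :=
  [ffun I : {ffun 'I_n -> sl2_basis} => t [ffun j => I (s j)]].

Definition tens_act s : 'End(tens n) := linfun (tens_act_fun s).

Lemma sl2_actE x (t : tens n) : sl2_act x t = sl2_act_fun x t.
Proof.
have lin : linear (sl2_act_fun x).
  move=> a u v; apply/ffunP=> I; rewrite !ffunE scaler_sumr -big_split /=.
  apply: eq_bigr => j _; rewrite scaler_sumr -big_split /=.
  apply: eq_bigr => y _; rewrite !ffunE mulrDr; congr (_ + _).
  by rewrite /GRing.scale /= mulrCA.
pose L := GRing.isLinear.Build _ _ _ _ _ lin.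
pose g : {linear tens n -> tens n} := HB.pack (sl2_act_fun x) L.
exact: (lfunE g).
Qed.

Lemma tens_actE s (t : tens n) : tens_act s t = tens_act_fun s t.
Proof.
have lin : linear (tens_act_fun s).
  by move=> a u v; apply/ffunP=> I; rewrite !ffunE.
pose L := GRing.isLinear.Build _ _ _ _ _ lin.
pose g : {linear tens n -> tens n} := HB.pack (tens_act_fun s) L.
exact: (lfunE g).
Qed.

Lemma tens_act1 : tens_act 1%g = \1%VF.
Proof.
apply/lfunP=> t; rewrite tens_actE id_lfunE; apply/ffunP=> I.
by rewrite ffunE; congr (t _); apply/ffunP=> j; rewrite ffunE perm1.
Qed.

Lemma tens_actM s t : tens_act (s * t)%g = (tens_act t \o tens_act s)%VF.
Proof.
apply/lfunP=> u; rewrite comp_lfunE !tens_actE; apply/ffunP=> I.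
by rewrite !ffunE; congr (u _); apply/ffunP=> j; rewrite !ffunE permM.
Qed.

Lemma sl2_tens_act x s (t : tens n) :
  sl2_act x (tens_act s t) = tens_act s (sl2_act x t).
Proof.
rewrite !sl2_actE !tens_actE; apply/ffunP=> I; rewrite !ffunE.
rewrite (reindex_inj (@perm_inj _ s)); apply: eq_bigr => j _.
apply: eq_bigr => y _; rewrite !ffunE; congr (_ * t _).
by apply/ffunP=> i; rewrite !ffunE (inj_eq perm_inj).
Qed.

Lemma Inv_stable s : (tens_act s @: Inv <= Inv)%VS.
Proof.
apply/subvP=> _ /memv_imgP[t tI ->].
have : (<[tens_act s t]> <= Inv)%VS; last by rewrite -memvE.
apply/subv_bigcapP=> x _; rewrite -memvE memv_ker sl2_tens_act.
move: tI; rewrite memvE => /subv_bigcapP/(_ x isT).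
by rewrite -memvE memv_ker => /eqP->; rewrite linear0.
Qed.

End Tensors.

(** * The weight system *)

Section WeightSystem.
Variable n : nat.

(* The contracted tensor of a tree in coordinates: the coefficient at I is a
   sum over the labelings x of the trivalent half-edges by basis vectors, with
   a factor b at each trivalent vertex, a factor kappa at each internal edge
   (taken once, thanks to the order on ranks), and the condition that the
   trivalent half-edge joined to the leg j is labeled by I j.  The factor c
   occurs only when an edge joins two legs, that is, for the strut (n = 2), in
   which case all the other products are empty. *)
Definition W_tree (T : tree n) : tens n :=
  let d : {perm half n n.-2} := val T in
  [ffun I : {ffun 'I_n -> sl2_basis} =>
    (\prod_(p : 'I_n * 'I_n | (p.1 < p.2)%N && (d (inl p.1) == inl p.2))
        c_coef (I p.1) (I p.2))
    * \sum_(x : {ffun 'I_n.-2 * 'I_3 -> sl2_basis})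
       (\prod_(v : 'I_n.-2)
          b_coef (x (v, inord 0)) (x (v, inord 1)) (x (v, inord 2)))
       * (\prod_(p : ('I_n.-2 * 'I_3) * ('I_n.-2 * 'I_3)
            | (enum_rank p.1 < enum_rank p.2)%N && (d (inr p.1) == inr p.2))
            kappa (x p.1) (x p.2))
       * (\prod_(p : 'I_n * ('I_n.-2 * 'I_3) | d (inl p.1) == inr p.2)
            (x p.2 == I p.1)%:R)].

Definition Wh : 'Hom(Cn n, tens n) := quot_lift (tree_rels n) (free_ext W_tree).

End WeightSystem.

(* Main.v *)
From HB Require Import structures.
From mathcomp Require Import all_boot all_order all_algebra all_fingroup.
From mathcomp Require Import ring zify.
Require Import Defs.

Set Implicit Arguments.
Unset Strict Implicit.
Unset Printing Implicit Defensive.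

Import GroupScope Order.TTheory GRing.Theory Num.Theory.
Local Open Scope ring_scope.

(** The weight system is well defined, invariant and equivariant.  The tensor of
    a diagram is rewritten as one contraction [net] in which every edge, internal
    or not, carries a symmetric two-variable coefficient.  A permutation of the
    half-edges then moves from the diagram to the labels ([net_conj]), so that
    isomorphisms, AS and IHX become the cyclic invariance of b, its antisymmetry
    and the Jacobi identity.  For invariance, sl_2 is made to act on one
    half-edge at a time: the two halves of an edge cancel, and so do the three
    half-edges at a trivalent vertex, hence the sum over the legs vanishes
    ([net_inv]).

    The image.  Let phi(t) be the coefficient of h (x) ... (x) h in t.  A tree
    with n > 2 legs has n - 2 trivalent vertices, so two legs meet at one vertex,
    where b(h, h, _) = 0: the image lies in the kernel of phi ([W_tree_h0]).
    Conversely every invariant t with phi(t) = 0 is in the image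
    ([Inv_hword_limg], by induction on n).  As an sl_2-module, the exterior
    square of sl_2 is sl_2 itself, so t - (0 1) t comes from an invariant with
    one factor less by applying the transpose of the bracket to a factor
    ([antisym_graft]); on the image of a tree this operation is the grafting of a
    cherry on a leg ([graft_tens_W]).  By conjugation and composition, t is
    congruent to all its permutations modulo such grafts, hence to a multiple of
    its average, a symmetric invariant killed by phi, and such a tensor is zero
    ([symmetric_Inv_eq0]).  There remains to see that the graft of every
    invariant q with n - 1 factors is in the image.  When n - 1 is odd, phi
    vanishes on invariants ([Inv_odd_hword]) and the induction hypothesis
    applies.  When n - 1 is even, one q with phi(q) <> 0 suffices: for n - 1 = 2
    the tensor of the strut, otherwise a product c (x) q'.  The graft of the
    latter is g = b (x) q', which changes sign under the transposition (0 2) of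
    the factors of b, while (2 3) g = g modulo the image.  Then (0 3), the
    conjugate of (2 3) by (0 2), also fixes g modulo the image, and so does
    (0 2), the conjugate of (2 3) by (0 3): hence 2 g is in the image
    ([graft_c_tens_sub]).

    Characters.  They are additive along V -> f(V) ([chi_exact]).  This is
    applied to the weight system on C_n and, for n even, to phi on the
    invariants, where phi is onto the trivial representation and has the image
    of the weight system as kernel. *)

Local Notation word n := {ffun 'I_n -> sl2_basis}.

(** * Enumerations and the identities of b, c and kappa *)

Lemma sl2_eqE : ((sl_h == sl_e) = false) * ((sl_h == sl_f) = false)
  * ((sl_e == sl_h) = false) * ((sl_e == sl_f) = false)
  * ((sl_f == sl_h) = false) * ((sl_f == sl_e) = false).
Proof. by do !split; apply/eqP. Qed.

Lemma sum_sl2 (F : sl2_basis -> rat) :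
  \sum_y F y = F sl_h + F sl_e + F sl_f.
Proof.
rewrite (bigD1 sl_h) //= (bigD1 sl_e) ?sl2_eqE //= (bigD1 sl_f) ?sl2_eqE //=.
rewrite big1 ?addr0 ?addrA // => y.
by case: y; rewrite ?eqxx ?andbF.
Qed.

Lemma inord3S : (ordS (inord 0 : 'I_3) = inord 1) * (ordS (inord 1 : 'I_3) = inord 2)
  * (ordS (inord 2 : 'I_3) = inord 0).
Proof. by split; [split|]; apply: val_inj; rewrite /= !inordK. Qed.

Variant ord3_spec : 'I_3 -> Type :=
  | Ord3_0 : ord3_spec (inord 0) | Ord3_1 : ord3_spec (inord 1)
  | Ord3_2 : ord3_spec (inord 2).

Lemma ord3P i : ord3_spec i.
Proof.
case: i => -[|[|[|//]]] Hi.
- have -> : Ordinal Hi = inord 0 by apply: val_inj; rewrite /= inordK.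
  by constructor.
- have -> : Ordinal Hi = inord 1 by apply: val_inj; rewrite /= inordK.
  by constructor.
- have -> : Ordinal Hi = inord 2 by apply: val_inj; rewrite /= inordK.
  by constructor.
Qed.

Lemma inord3E : ((inord 0 == inord 1 :> 'I_3) = false)
  * ((inord 0 == inord 2 :> 'I_3) = false)
  * ((inord 1 == inord 0 :> 'I_3) = false)
  * ((inord 1 == inord 2 :> 'I_3) = false)
  * ((inord 2 == inord 0 :> 'I_3) = false)
  * ((inord 2 == inord 1 :> 'I_3) = false).
Proof. by do !split; rewrite -val_eqE /= !inordK. Qed.

Lemma sum_ord3 (F : 'I_3 -> rat) :
  \sum_i F i = F (inord 0) + F (inord 1) + F (inord 2).
Proof.
rewrite !big_ord_recl big_ord0 addr0 addrA; congr (F _ + F _ + F _);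
  by apply: val_inj; rewrite /= inordK.
Qed.

Lemma b_cyc x y z : b_coef x y z = b_coef y z x.
Proof. by case: x; case: y; case: z. Qed.

Lemma b_anti x y z : b_coef y x z = - b_coef x y z.
Proof. by case: x; case: y; case: z. Qed.

Lemma kappa_sym x y : kappa x y = kappa y x.
Proof. by case: x; case: y. Qed.

Lemma c_sym x y : c_coef x y = c_coef y x.
Proof. by case: x; case: y. Qed.

Lemma kappa_cK x z : \sum_y kappa x y * c_coef y z = (x == z)%:R.
Proof. by rewrite sum_sl2; case: x; case: z; rewrite ?eqxx ?sl2_eqE; vm_compute. Qed.

(** A label on a trivalent half-edge is paired with a coefficient of b, so it
    transforms by the dual of the adjoint action; hence the sign and the order
    of the arguments, opposite to those of [c_inv] and [b_inv]. *)
Lemma kappa_inv X a b :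
  \sum_y - sl2_bracket X a y * kappa y b
  + \sum_y - sl2_bracket X b y * kappa a y = 0.
Proof. by rewrite !sum_sl2; case: X; case: a; case: b; vm_compute. Qed.

Lemma c_inv X a b :
  \sum_y sl2_bracket X y a * c_coef y b
  + \sum_y sl2_bracket X y b * c_coef a y = 0.
Proof. by rewrite !sum_sl2; case: X; case: a; case: b; vm_compute. Qed.

Lemma b_inv X a b c :
  \sum_y sl2_bracket X y a * b_coef y b c
  + \sum_y sl2_bracket X y b * b_coef a y c
  + \sum_y sl2_bracket X y c * b_coef a b y = 0.
Proof. by rewrite !sum_sl2; case: X; case: a; case: b; case: c; vm_compute. Qed.

(** The three terms are those of IHX, with the roots of the two vertices
    contracted; a, b, c are permuted cyclically. *)
Lemma b_jacobi a b c e :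
  \sum_y \sum_z kappa y z * (b_coef y a b * b_coef z c e
    + b_coef y c a * b_coef z b e + b_coef y b c * b_coef z a e) = 0.
Proof. by rewrite !sum_sl2; case: a; case: b; case: c; case: e; vm_compute. Qed.

(** * Changing one label *)

Section Update.
Variables (T Y : finType).
Implicit Types (x : {ffun T -> Y}) (p q : T).

Definition upd x p y : {ffun T -> Y} := [ffun q => if q == p then y else x q].

Lemma upd_same x p y : upd x p y p = y.
Proof. by rewrite ffunE eqxx. Qed.

Lemma upd_other x p q y : q != p -> upd x p y q = x q.
Proof. by rewrite ffunE => /negPf->. Qed.

Lemma upd_upd x p y z : upd (upd x p y) p z = upd x p z.
Proof. by apply/ffunP=> q; rewrite !ffunE; case: eqP. Qed.

Lemma upd_id x p : upd x p (x p) = x.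
Proof. by apply/ffunP=> q; rewrite ffunE; case: eqP => // ->. Qed.

(** Summation by parts: x and y swap the roles of the old and the new label
    at p, an involution of the pairs. *)
Lemma sum_upd (M : nmodType) (G : {ffun T -> Y} -> Y -> M) p :
  \sum_x \sum_y G x y = \sum_x \sum_y G (upd x p y) (x p).
Proof.
rewrite !pair_big /=.
pose sw (z : {ffun T -> Y} * Y) := (upd z.1 p z.2, z.1 p).
rewrite (@reindex_inj _ _ _ _ sw) //; apply: inv_inj => -[x y].
by rewrite /sw /= upd_upd upd_id upd_same.
Qed.

(** A sum over all labelings vanishes as soon as it does when one label varies
    and the others are fixed. *)
Lemma sum_upd0 (G : {ffun T -> Y} -> rat) p : (0 < #|Y|)%N ->
  (forall x, \sum_y G (upd x p y) = 0) -> \sum_x G x = 0.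
Proof.
move=> Y0 G0; have := sum_upd (fun x _ => G x) p.
rewrite [RHS]big1 //; under eq_bigr do rewrite sumr_const.
rewrite sumrMnl => /eqP; rewrite mulrn_eq0 => /orP[/eqP Y_0|/eqP //].
by rewrite Y_0 in Y0.
Qed.

Lemma sum_upd2_0 (G : {ffun T -> Y} -> rat) p q : (0 < #|Y|)%N ->
  (forall x, \sum_y \sum_z G (upd (upd x p y) q z) = 0) -> \sum_x G x = 0.
Proof.
move=> Y0 G0; have := sum_upd0 (G := fun x => \sum_z G (upd x q z)) Y0 G0.
rewrite -(sum_upd (fun x _ => G x)).
under eq_bigr do rewrite sumr_const.
rewrite sumrMnl => /eqP; rewrite mulrn_eq0 => /orP[/eqP Y_0|/eqP //].
by rewrite Y_0 in Y0.
Qed.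

End Update.

(** * Contraction networks *)

Section Orientation.
Variables (T : finType) (d : {perm T}).
Hypothesis dK : forall h, d (d h) = h.

(** A product over edges is taken over one half of each edge; o and o' select
    the halves. *)
Lemma prod_orient (R : comPzSemiRingType) (o o' : pred T) (F : T -> R) :
  (forall h, o (d h) = ~~ o h) -> (forall h, o' (d h) = ~~ o' h) ->
  (forall h, F (d h) = F h) -> \prod_(h | o h) F h = \prod_(h | o' h) F h.
Proof.
move=> od o'd Fd; rewrite (bigID o') /= [RHS](bigID o) /=; congr (_ * _).
  by apply: eq_bigl => h; rewrite andbC.
rewrite (reindex_inj (@perm_inj _ d)) /=.
by apply: eq_big => h; rewrite ?od ?o'd ?negbK 1?andbC ?Fd.
Qed.

Lemma prod_orient_split (R : comPzSemiRingType) (o : pred T) (F : T -> R) h :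
  (forall h, o (d h) = ~~ o h) -> (forall h, F (d h) = F h) ->
  \prod_(h' | o h') F h' = F h * \prod_(h' | o h' && ((h' != h) && (h' != d h))) F h'.
Proof.
move=> od Fd; wlog oh : h / o h.
  move=> W; case: (boolP (o h)) => [/W //|noh].
  rewrite (W (d h)) ?od // Fd dK; congr (_ * _).
  by apply: eq_bigl => h'; rewrite [_ && (h' != h)]andbC.
rewrite (bigD1 h) //=; congr (_ * _); apply: eq_bigl => h'.
case: (h' =P d h) => [->|_]; rewrite ?andbT //.
by rewrite od oh.
Qed.

End Orientation.

Definition is_leg n k (h : half n k) := if h is inl _ then true else false.

(** The coefficient of the edge between two half-edges with labels a and b: a
    leg forces the label of the trivalent half-edge that it meets. *)
Definition edge_coef n k (h h' : half n k) (a b : sl2_basis) : rat :=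
  match h, h' with
  | inl _, inl _ => c_coef a b
  | inr _, inr _ => kappa a b
  | _, _ => (a == b)%:R
  end.

Lemma edge_coef_leg n k n' k' (h1 h2 : half n k) (h1' h2' : half n' k') a b :
  is_leg h1 = is_leg h1' -> is_leg h2 = is_leg h2' ->
  edge_coef h1 h2 a b = edge_coef h1' h2' a b.
Proof. by case: h1 h1' h2 h2' => ? [] ? [] ? [] ?. Qed.

Section Networks.
Variables n k : nat.
Local Notation H := (half n k).
Implicit Types (d s : {perm H}) (h : H) (l : {ffun H -> sl2_basis}).
Implicit Types (I : word n) (x : {ffun 'I_k * 'I_3 -> sl2_basis}).

Lemma edge_coef_sym h h' a b : edge_coef h' h b a = edge_coef h h' a b.
Proof. by case: h h' => i [] j //=; rewrite 1?c_sym 1?kappa_sym 1?eq_sym. Qed.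

(** The choice of halves implicit in the weight system: legs come first, and
    two halves of the same kind are compared by their numbers. *)
Definition orient d h :=
  match h, d h with
  | inl i, inl j => (i < j)%N
  | inl _, inr _ => true
  | inr _, inl _ => false
  | inr p, inr q => (enum_rank p < enum_rank q)%N
  end.

Definition edges d l := \prod_(h | orient d h) edge_coef h (d h) (l h) (l (d h)).

Definition lab I x : {ffun H -> sl2_basis} :=
  [ffun h => match h with inl j => I j | inr p => x p end].

Definition vcoef x v := b_coef (x (v, inord 0)) (x (v, inord 1)) (x (v, inord 2)).

(** The contracted tensor of an arbitrary diagram, connected or not. *)
Definition net d I : rat := \sum_x (\prod_v vcoef x v) * edges d (lab I x).

Lemma diagK d h : is_diagram d -> d (d h) = h.
Proof. by move=> /forallP/(_ h)/andP[/eqP]. Qed.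

Lemma diag_neq d h : is_diagram d -> d h != h.
Proof. by move=> /forallP/(_ h)/andP[_]. Qed.

Lemma orientP d h : is_diagram d -> orient d (d h) = ~~ orient d h.
Proof.
move=> dP; have := diagK h dP; have := diag_neq h dP; rewrite /orient.
case: h => i; case E: (d _) => [j|j] ne dd; rewrite dd ?E //= -leqNgt [RHS]leq_eqVlt;
  case: eqP => [/val_inj e|] //.
  by rewrite e eqxx in ne.
by rewrite (enum_rank_inj e) eqxx in ne.
Qed.

Lemma edge_coef_diag d l h : is_diagram d ->
  edge_coef (d h) (d (d h)) (l (d h)) (l (d (d h))) = edge_coef h (d h) (l h) (l (d h)).
Proof. by move=> dP; rewrite diagK // edge_coef_sym. Qed.

Lemma edges_split d l h : is_diagram d ->
  edges d l = edge_coef h (d h) (l h) (l (d h)) *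
   \prod_(h' | orient d h' && ((h' != h) && (h' != d h)))
      edge_coef h' (d h') (l h') (l (d h')).
Proof.
move=> dP; apply: (prod_orient_split (d := d)) => h'.
- exact: (diagK h' dP).
- exact: orientP.
- exact: edge_coef_diag.
Qed.

(** The other edges do not see a change of label on either half of the edge
    of h. *)
Lemma edges_rest_upd d l h h0 y : is_diagram d -> (h0 = h) + (h0 = d h) ->
  let R l := \prod_(h' | orient d h' && ((h' != h) && (h' != d h)))
      edge_coef h' (d h') (l h') (l (d h')) in R (upd l h0 y) = R l.
Proof.
move=> dP h0h /=; apply: eq_bigr => h' /andP[_ /andP[h'h h'dh]].
rewrite !upd_other //.
  case: h0h => ->; apply: contraNneq (h'h) => e; apply/eqP.
    by rewrite -e diagK // eqxx in h'dh.
  exact: (@perm_inj _ d).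
by case: h0h => ->.
Qed.

(** Conjugating the diagram amounts to moving the labels.  This holds as soon
    as s preserves the two kinds of half-edges, so that it covers both the
    relabeling of the legs and the moves at trivalent vertices. *)
Lemma edges_conj d s l : is_diagram d -> (forall h, is_leg (s h) = is_leg h) ->
  edges (d ^ s)%g l = edges d [ffun h => l (s h)].
Proof.
move=> dP sl; have dsP : is_diagram (d ^ s)%g.
  apply/forallP=> h; rewrite -[h](permKV s) !permJ.
  by rewrite !(inj_eq perm_inj) diagK ?eqxx ?diag_neq.
rewrite /edges (reindex_inj (@perm_inj _ s)) /=.
rewrite (prod_orient (d := d) (o' := orient d)).
- apply: eq_bigr => h _; rewrite permJ !ffunE.
  exact: edge_coef_leg.
- by move=> h; rewrite -permJ orientP.
- by move=> h; exact: orientP.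
- by move=> h; rewrite -permJ edge_coef_diag.
Qed.

End Networks.

Lemma prod_guard (R : pzSemiRingType) (J : finType) (P : pred J) (j0 : J) (b : bool)
    (F : J -> R) :
  (forall j, P j = b && (j == j0)) -> \prod_(j | P j) F j = if b then F j0 else 1.
Proof.
move=> PE; rewrite (eq_bigl _ _ PE); case: b {PE}; last exact: big_pred0.
exact: big_pred1.
Qed.

(** The three products over pairs have at most one factor for each half-edge,
    the one at its partner. *)
Lemma W_treeE n (T : tree n) I : W_tree T I = net (val T) I.
Proof.
rewrite /W_tree ffunE /net mulr_sumr; apply: eq_bigr => x _.
set d := val T; rewrite mulrCA -mulrA; congr (_ * _).
rewrite -(pair_big_dep xpredT (fun i j : 'I_n => (i < j)%N && (d (inl i) == inl j))
  (fun i j => c_coef (I i) (I j))) /=.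
rewrite -(pair_big_dep xpredT (fun p q : 'I_n.-2 * 'I_3 => (enum_rank p < enum_rank q)%N
  && (d (inr p) == inr q)) (fun p q => kappa (x p) (x q))) /=.
rewrite -(pair_big_dep xpredT (fun (i : 'I_n) (q : 'I_n.-2 * 'I_3) => d (inl i) == inr q)
  (fun i q => (x q == I i)%:R)) /=.
rewrite mulrC -big_split /= /edges big_sumType /=; congr (_ * _).
  rewrite [RHS]big_mkcond; apply: eq_bigr => i _; rewrite /orient.
  case e : (d (inl i)) => [j0|q0] /=.
    rewrite [X in _ * X]big_pred0 => [|q]; last by apply/eqP.
    rewrite mulr1 (prod_guard (j0 := j0) (b := (i < j0)%N)) ?ffunE // => j.
    rewrite (inj_eq (@inl_inj _ _)) eq_sym.
    by case: eqP => [->|]; rewrite ?andbF.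
  rewrite big_pred0 => [|j]; last by rewrite andbC; case: eqP.
  rewrite mul1r (prod_guard (j0 := q0) (b := true)) ?ffunE 1?eq_sym //.
rewrite [RHS]big_mkcond; apply: eq_bigr => p _; rewrite /orient.
case e : (d (inr p)) => [j0|q0] /=.
  by rewrite big_pred0 // => q; rewrite andbC; case: eqP.
rewrite (prod_guard (j0 := q0) (b := (enum_rank p < enum_rank q0)%N)) ?ffunE // => q.
rewrite (inj_eq (@inr_inj _ _)) eq_sym.
by case: eqP => [->|]; rewrite ?andbF.
Qed.

(** * Isomorphisms, AS and IHX *)

Section Relations.
Variables n k : nat.
Local Notation H := (half n k).
Implicit Types (d s : {perm H}) (h : H) (l : {ffun H -> sl2_basis}) (u : {perm 'I_k * 'I_3}).
Implicit Types (I : word n) (x : {ffun 'I_k * 'I_3 -> sl2_basis}).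

Definition permuted u x : {ffun 'I_k * 'I_3 -> sl2_basis} := [ffun p => x ((u^-1)%g p)].

Lemma permuted_bij u : bijective (permuted u).
Proof.
exists (permuted (u^-1)%g) => x; apply/ffunP=> p;
  by rewrite !ffunE ?permK ?permKV ?invgK ?permK ?permKV.
Qed.

(** A permutation u of the trivalent half-edges of the diagram acts on the
    vertex coefficients only, the labels on the edges being reindexed. *)
Lemma net_conj d s u I : is_diagram d -> (forall j, s (inl j) = inl j) ->
  (forall p, s (inr p) = inr (u p)) ->
  net (d ^ s)%g I = \sum_x (\prod_v vcoef (permuted u x) v) * edges d (lab I x).
Proof.
move=> dP sl sr; rewrite /net (reindex (permuted u)) /=; last first.
  exact/onW_bij/permuted_bij.
apply: eq_bigr => x _; rewrite edges_conj //; last by case=> i; rewrite ?sl ?sr.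
congr (_ * edges d _); apply/ffunP=> -[j|p]; rewrite ffunE ?sl ?sr !ffunE //.
by rewrite permK.
Qed.

Lemma vcoef_rot x v i :
  vcoef x v = b_coef (x (v, i)) (x (v, ordS i)) (x (v, ordS (ordS i))).
Proof.
rewrite /vcoef; case: (ord3P i); rewrite !inord3S // b_cyc //.
by rewrite b_cyc.
Qed.

Lemma next_inr (p : 'I_k * 'I_3) : next_half (inr p : H) = inr (p.1, ordS p.2).
Proof. by []. Qed.

Definition nxt (p : 'I_k * 'I_3) := (p.1, ordS p.2).

(** A permutation commuting with the cyclic orders permutes the vertices and
    rotates the half-edges at each of them, and b is invariant under rotation. *)
Lemma prod_vcoef_rot u x : (forall p, u (nxt p) = nxt (u p)) ->
  \prod_v vcoef (permuted u x) v = \prod_v vcoef x v.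
Proof.
move=> un; set w := (u^-1)%g.
have wn p : w (nxt p) = nxt (w p).
  by apply: (@perm_inj _ u); rewrite un /w !permKV.
pose f v := (w (v, ord0)).1.
have vf v : vcoef (permuted u x) v = vcoef x (f v).
  rewrite (vcoef_rot x (f v) (w (v, ord0)).2) (vcoef_rot _ v ord0) !ffunE.
  rewrite -/w -[(v, ordS (ordS ord0))]/(nxt (nxt (v, ord0))) !wn.
  by rewrite /f; case: (w _).
have f_inj : injective f.
  move=> v v' e.
  (* Half-edges of v and v' sent to the same vertex differ by a rotation there,
     which w carries back to a rotation at v'. *)
  have [j ej] : exists j, w (v, ord0) = w (v', j).
    have : (w (v, ord0)).2 \in [:: (w (v', ord0)).2; (nxt (w (v', ord0))).2;
        (nxt (nxt (w (v', ord0)))).2].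
      rewrite !inE /=; move: (w (v, ord0)).2 (w (v', ord0)).2 => a b.
      by case: (ord3P a); case: (ord3P b); rewrite !inord3S !inord3E ?eqxx.
    rewrite !inE => /or3P[] /eqP e2.
    + by exists ord0; apply/eqP; rewrite -pair_eqE /= e2 !eqxx andbT; apply/eqP.
    + exists (ordS ord0); rewrite -[(v', _)]/(nxt (v', ord0)) wn.
      by apply/eqP; rewrite -pair_eqE /= e2 !eqxx andbT; apply/eqP.
    + exists (ordS (ordS ord0)); rewrite -[(v', _)]/(nxt (nxt (v', ord0))) !wn.
      by apply/eqP; rewrite -pair_eqE /= e2 !eqxx andbT; apply/eqP.
  by have [] := perm_inj ej.
by rewrite [RHS](reindex_inj f_inj) /=; apply: eq_bigr.
Qed.

Lemma net_iso d d' I : is_diagram d -> iso_rel d d' -> net d' I = net d I.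
Proof.
move=> dP /existsP[s /andP[/andP[/forallP sl /forallP sn] /eqP ->]].
have slE j : s (inl j) = inl j by apply/eqP.
have snE h : s (next_half h) = next_half (s h) by apply/eqP.
pose f p := if s (inr p) is inr q then q else p.
have sf p : s (inr p) = inr (f p).
  rewrite /f; case e : (s _) => [j|//].
  by have := slE j; rewrite -e => /perm_inj.
have f_inj : injective f.
  by move=> p q e; have := sf p; rewrite e -sf => /perm_inj[].
rewrite (net_conj (u := perm f_inj)) // => [|p]; last by rewrite permE.
apply: eq_bigr => x _; rewrite prod_vcoef_rot // => p; rewrite !permE.
by have := snE (inr p); rewrite next_inr !sf next_inr => -[].
Qed.

Lemma prod_vcoef_tperm p x :
  \prod_v vcoef (permuted (tperm p (nxt p)) x) v = - \prod_v vcoef x v.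
Proof.
case: p => v i; rewrite (bigD1 v) //= [in RHS](bigD1 v) //= -mulNr; congr (_ * _).
  rewrite !(vcoef_rot _ v i) !ffunE tpermV tpermL tpermR tpermD.
  - by rewrite b_anti.
  - by rewrite /nxt /=; case: (ord3P i); rewrite !inord3S -pair_eqE /= inord3E andbF.
  - by rewrite /nxt /=; case: (ord3P i); rewrite !inord3S -pair_eqE /= inord3E andbF.
apply: eq_bigr => w wv; rewrite /vcoef !ffunE tpermV.
by rewrite !tpermD // -pair_eqE /= eq_sym (negPf wv).
Qed.

Lemma net_as d d' I : is_diagram d -> as_rel d d' -> net d I + net d' I = 0.
Proof.
move=> dP /existsP[p /eqP ->].
rewrite (net_conj (u := tperm p (nxt p))) // => [|j|q].
- rewrite /net -big_split /=; apply: big1 => x _.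
  by rewrite prod_vcoef_tperm mulNr subrr.
- by rewrite next_inr tpermD.
- rewrite next_inr; case: (tpermP p (nxt p) q) => [->|->|/eqP np /eqP nq].
  + by rewrite tpermL.
  + by rewrite tpermR.
  + by rewrite tpermD // (inj_eq (@inr_inj _ _)) eq_sym.
Qed.

Lemma lab_upd_inr I x p y :
  lab I (upd x p y) = upd (lab I x) (inr p) y :> {ffun H -> sl2_basis}.
Proof. by apply/ffunP=> -[j|q]; rewrite !ffunE. Qed.

Lemma vcoef_at x p : vcoef x p.1 = b_coef (x p) (x (nxt p)) (x (nxt (nxt p))).
Proof. by case: p => v i; rewrite (vcoef_rot _ v i). Qed.

Lemma nxt_neq (p : 'I_k * 'I_3) : (nxt p == p) = false.
Proof.
case: p => v i; rewrite -pair_eqE /=.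
by case: (ord3P i); rewrite !inord3S inord3E andbF.
Qed.

Lemma nxt2_neq (p : 'I_k * 'I_3) : (nxt (nxt p) == p) = false.
Proof.
case: p => v i; rewrite -pair_eqE /=.
by case: (ord3P i); rewrite !inord3S inord3E andbF.
Qed.

(** The sum over the two labels y and z of the internal edge pq is the Jacobi
    identity [b_jacobi] times the coefficients of the other vertices and edges. *)
Lemma net_ihx_sum I d p q u : is_diagram d -> d (inr p) = inr q -> p.1 != q.1 ->
  let a := nxt p in let b := nxt a in let c := nxt q in
  u a = b -> u b = c -> u c = a ->
  (forall r, r != a -> r != b -> r != c -> u r = r) ->
  \sum_x (\prod_v vcoef x v + \prod_v vcoef (permuted u x) v
     + \prod_v vcoef (permuted (u * u)%g x) v) * edges d (lab I x) = 0.
Proof.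
move=> dP dpq pq a b c ua ub uc uD.
have B0 : (0 < #|{: sl2_basis}|)%N by apply/card_gt0P; exists sl_h.
have va : (u^-1)%g a = c by rewrite -uc permK.
have vb : (u^-1)%g b = a by rewrite -ua permK.
have vc : (u^-1)%g c = b by rewrite -ub permK.
have vD r : r != a -> r != b -> r != c -> (u^-1)%g r = r.
  by move=> ra rb rc; rewrite -{1}(uD r ra rb rc) permK.
have ne r r' : r.1 != r'.1 -> (r == r') = false.
  by move=> e; apply: contraNF e => /eqP->.
have qp : q.1 != p.1 by rewrite eq_sym.
pose e := nxt c.
have ap : (p == a) = false by rewrite eq_sym; exact: nxt_neq.
have bp : (p == b) = false by rewrite eq_sym; exact: nxt2_neq.
have cq : (q == c) = false by rewrite eq_sym; exact: nxt_neq.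
have ec : (e == c) = false by exact: nxt_neq.
have eq : (e == q) = false by exact: nxt2_neq.
have cq' : (c == q) = false by exact: nxt_neq.
have ap' : (a == p) = false by exact: nxt_neq.
have bp' : (b == p) = false by exact: nxt2_neq.
have vp : (u^-1)%g p = p by rewrite vD ?ap ?bp ?ne.
have vq : (u^-1)%g q = q by rewrite vD ?cq ?ne.
have ve : (u^-1)%g e = e by rewrite vD ?ec ?ne.
have vO v i : v != p.1 -> v != q.1 -> (u^-1)%g (v, i) = (v, i).
  by move=> vp' vq'; rewrite vD ?ne.
apply: (sum_upd2_0 (p := p) (q := q)) => // x.
pose R := \prod_(v | (v != p.1) && (v != q.1)) vcoef x v.
have split (X : {ffun 'I_k * 'I_3 -> sl2_basis}) :
    (forall v i, v != p.1 -> v != q.1 -> X (v, i) = x (v, i)) ->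
    \prod_v vcoef X v = b_coef (X p) (X a) (X b) * b_coef (X q) (X c) (X e) * R.
  move=> XO; rewrite (bigD1 p.1) //= (bigD1 q.1) //= mulrA !vcoef_at; congr (_ * _).
  by apply: eq_bigr => v /andP[v1 v2]; rewrite /vcoef !XO.
have upO y z v i : v != p.1 -> v != q.1 -> upd (upd x p y) q z (v, i) = x (v, i).
  by move=> v1 v2; rewrite !upd_other ?ne.
have [S ES] : exists S, forall y z, edges d (lab I (upd (upd x p y) q z)) = kappa y z * S.
  eexists => y z; rewrite (edges_split _ (inr p)) // dpq /= !ffunE eqxx ne // eqxx.
  congr (_ * _); rewrite !lab_upd_inr.
  have := edges_rest_upd (h0 := inr q) (h := inr p) (upd (lab I x) (inr p) y) z dP.
  rewrite dpq => ->; last by right.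
  have := edges_rest_upd (h0 := inr p) (h := inr p) (lab I x) y dP.
  by rewrite dpq => ->; last by left.
have J := congr1 ( *%R (R * S)) (b_jacobi (x a) (x b) (x c) (x e)).
apply: etrans (etrans J (mulr0 _)); rewrite mulr_sumr; apply: eq_bigr => y _.
rewrite mulr_sumr; apply: eq_bigr => z _.
rewrite ES (split (upd (upd x p y) q z)); last exact: upO.
rewrite split => [|v i v1 v2]; last by rewrite ffunE vO // upO.
rewrite split => [|v i v1 v2]; last by rewrite ffunE invMg permM !vO // upO.
rewrite !ffunE invMg !permM !(vp, vq, ve, va, vb, vc).
rewrite !eqxx ap' bp' cq' eq !ne //. ring.
Qed.

Lemma net_ihx d d' d'' I : is_tree d -> ihx_rel d d' d'' ->
  net d I + net d' I + net d'' I = 0.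
Proof.
case/and3P=> dP _ dA /existsP[p /existsP[q /and3P[/eqP dpq /eqP-> /eqP->]]].
(* An edge from a vertex to itself is a cycle of length 1. *)
have pq : p.1 != q.1.
  apply/negP=> /eqP e; have sz : (size [:: inr p : H] <= n + k)%N.
    by case: p {dpq} e => v i _; apply: leq_trans (leq_addl _ _); case: (k) v => [[]|].
  have /negP[] := forallP dA (Bseq sz).
  by rewrite /is_cycle /= /step /= dpq /= e eqxx /= andbT -dpq eq_sym diag_neq.
pose a := nxt p; pose b := nxt a; pose c := nxt q.
pose u := (tperm a b * tperm a c)%g.
have ab : b != a by rewrite nxt_neq.
have ac : c != a by apply: contraNneq pq => /(congr1 fst) /= ->.
have bc : c != b by apply: contraNneq pq => /(congr1 fst) /= ->.
have tpE (r r' r'' : 'I_k * 'I_3) :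
    tperm (inr r) (inr r') (inr r'' : H) = inr (tperm r r' r'').
  case: (tpermP r r' r'') => [->|->|/eqP h /eqP h']; rewrite ?tpermL ?tpermR //.
  by rewrite tpermD // (inj_eq (@inr_inj _ _)) eq_sym.
have sE r : ihx_perm n p q (inr r) = inr (u r) by rewrite /ihx_perm !next_inr !permM !tpE.
have sl j : ihx_perm n p q (inl j) = inl j by rewrite /ihx_perm !next_inr permM !tpermD.
rewrite -conjgM (net_conj (u := u)) // (net_conj (u := (u * u)%g)) //; last 2 first.
- by move=> j; rewrite permM !sl.
- by move=> r; rewrite permM sE sE [in RHS]permM.
rewrite /net -!big_split /=; under eq_bigr do rewrite -!mulrDl.
apply: (net_ihx_sum _ dP dpq pq) => [|||r ra rb rc].
- by rewrite permM tpermL tpermD // eq_sym.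
- by rewrite permM tpermR tpermL.
- have cE : tperm a b c = c by rewrite tpermD // eq_sym.
  by rewrite permM cE tpermR.
- by rewrite permM !tpermD // eq_sym.
Qed.

End Relations.

(** * Invariance under sl_2 *)

Section Invariance.
Variables (n k : nat) (X : sl2_basis).
Local Notation H := (half n k).
Implicit Types (d s : {perm H}) (h : H) (l : {ffun H -> sl2_basis}).
Implicit Types (I : word n) (x : {ffun 'I_k * 'I_3 -> sl2_basis}).

(** A leg indexes a tensor factor and a trivalent half-edge an argument of b, so
    that X acts on their labels by dual actions. *)
Definition ad_half h (a y : sl2_basis) :=
  if is_leg h then sl2_bracket X y a else - sl2_bracket X a y.

Definition ad_edges d h l := \sum_y ad_half h (l h) y * edges d (upd l h y).

(** With the two actions of [ad_half], all three kinds of edge coefficients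
    are invariant; for a leg joined to a trivalent half-edge this is the duality
    of these actions. *)
Lemma edge_coef_inv h h' (a b : sl2_basis) :
  \sum_y ad_half h a y * edge_coef h h' y b
  + \sum_y ad_half h' b y * edge_coef h h' a y = 0.
Proof.
case: h h' => i [] j; rewrite /ad_half /=.
- exact: c_inv.
- by rewrite !sum_sl2; case: X; case: a; case: b; rewrite ?eqxx ?sl2_eqE; vm_compute.
- by rewrite !sum_sl2; case: X; case: a; case: b; rewrite ?eqxx ?sl2_eqE; vm_compute.
- exact: kappa_inv.
Qed.

Lemma ad_edges_pair d h l : is_diagram d -> ad_edges d h l + ad_edges d (d h) l = 0.
Proof.
move=> dP; pose R := \prod_(h' | orient d h' && ((h' != h) && (h' != d h)))
      edge_coef h' (d h') (l h') (l (d h')).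
have E1 y : edges d (upd l h y) = edge_coef h (d h) y (l (d h)) * R.
  rewrite (edges_split _ h) // upd_same upd_other ?diag_neq //; congr (_ * _).
  by have /= -> // := edges_rest_upd (h := h) (h0 := h) l y dP; last by left.
have E2 y : edges d (upd l (d h) y) = edge_coef h (d h) (l h) y * R.
  rewrite (edges_split _ h) // upd_same upd_other 1?eq_sym ?diag_neq //.
  congr (_ * _).
  by have /= -> // := edges_rest_upd (h := h) (h0 := d h) l y dP; last by right.
rewrite /ad_edges; under eq_bigr do rewrite E1 mulrA.
under [X in _ + X]eq_bigr do rewrite E2 mulrA.
by rewrite -!mulr_suml -mulrDl edge_coef_inv mul0r.
Qed.

(** The halves of each edge cancel; summing over h and over d h counts every
    edge twice. *)
Lemma ad_edges_sum d l : is_diagram d -> \sum_h ad_edges d h l = 0.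
Proof.
move=> dP; set S := \sum_h _.
have : S + S = 0.
  rewrite {2}/S (reindex_inj (@perm_inj _ d)) -big_split /=.
  by apply: big1 => h _; rewrite ad_edges_pair.
by move/eqP; rewrite -mulr2n mulrn_eq0 => /eqP.
Qed.

Lemma vertex_inv x v :
  \sum_(i < 3) \sum_y sl2_bracket X y (x (v, i)) * \prod_w vcoef (upd x (v, i) y) w = 0.
Proof.
pose R := \prod_(w | w != v) vcoef x w.
have E i y : \prod_w vcoef (upd x (v, i) y) w = vcoef (upd x (v, i) y) v * R.
  rewrite (bigD1 v) //=; congr (_ * _); apply: eq_bigr => w wv.
  by rewrite /vcoef !upd_other // -pair_eqE /= (negPf wv).
under eq_bigr do under eq_bigr do rewrite E mulrA.
under eq_bigr do rewrite -mulr_suml.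
rewrite -mulr_suml sum_ord3 /vcoef.
pose K := b_inv X (x (v, inord 0)) (x (v, inord 1)) (x (v, inord 2)).
rewrite -[RHS](mul0r R) -[in RHS]K; congr ((_ + _ + _) * _); apply: eq_bigr => y _;
 by rewrite !ffunE -!pair_eqE /= !eqxx !inord3E.
Qed.

(** Summation by parts moves the dual action from the edges to the vertex
    coefficients, where it is the adjoint action and b is invariant. *)
Lemma ad_vertices_sum d I :
  \sum_x (\prod_v vcoef x v) * \sum_p ad_edges d (inr p) (lab I x) = 0.
Proof.
under eq_bigr do rewrite mulr_sumr.
rewrite exchange_big /=.
have E (p : 'I_k * 'I_3) : \sum_x (\prod_v vcoef x v) * ad_edges d (inr p) (lab I x)
  = - \sum_x edges d (lab I x) * \sum_y sl2_bracket X y (x p) * \prod_w vcoef (upd x p y) w.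
  rewrite -sumrN; under eq_bigr do rewrite mulr_sumr.
  under [RHS]eq_bigr do rewrite mulr_sumr -sumrN.
  rewrite (sum_upd _ p); apply: eq_bigr => x _; apply: eq_bigr => y _.
  rewrite -lab_upd_inr upd_upd upd_id /ad_half /= !ffunE eqxx; ring.
under eq_bigr do rewrite E.
rewrite sumrN exchange_big big1 ?oppr0 // => x _; rewrite -mulr_sumr.
rewrite (_ : \sum_p _ = 0) ?mulr0 //.
transitivity (\sum_v \sum_(i < 3) \sum_y sl2_bracket X y (x (v, i)) *
     \prod_w vcoef (upd x (v, i) y) w).
  by rewrite [RHS]pair_bigA; apply: eq_bigr => -[v i] _.
by apply: big1 => v _; exact: vertex_inv.
Qed.

(** The action on the legs is what remains of the action on all half-edges
    once the trivalent ones have cancelled. *)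
Lemma net_inv d I : is_diagram d ->
  \sum_(j < n) \sum_y sl2_bracket X y (I j) * net d (set_factor I j y) = 0.
Proof.
move=> dP.
transitivity (\sum_x (\prod_v vcoef x v) * \sum_(j < n) ad_edges d (inl j) (lab I x)).
  under [RHS]eq_bigr do rewrite mulr_sumr.
  rewrite [RHS]exchange_big; apply: eq_bigr => j _.
  under [LHS]eq_bigr do rewrite /net mulr_sumr.
  rewrite [LHS]exchange_big; apply: eq_bigr => x _ /=.
  rewrite /ad_edges mulr_sumr; apply: eq_bigr => y _.
  rewrite /ad_half /= !ffunE mulrCA; congr (_ * (_ * edges d _)).
  by apply/ffunP=> -[i|p]; rewrite !ffunE.
transitivity (- \sum_x (\prod_v vcoef x v) * \sum_p ad_edges d (inr p) (lab I x)).
  rewrite -sumrN; apply: eq_bigr => x _; rewrite -mulrN; congr (_ * _).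
  apply/eqP; rewrite -subr_eq0 opprK; apply/eqP.
  by have := ad_edges_sum (lab I x) dP; rewrite big_sumType.
by rewrite ad_vertices_sum oppr0.
Qed.

End Invariance.

(** * The weight system on trees *)

(** The coefficient at this word is the functional that separates the
    invariants from the image of the weight system. *)
Definition hword n : word n := [ffun=> sl_h].

Section WeightSystem.
Variable n : nat.
Implicit Types (T : tree n) (s : 'S_n).

Lemma tree_diagram T : is_diagram (val T).
Proof. by case/and3P: (valP T). Qed.

Lemma Wh_class T : Wh n (tree_class T) = W_tree T.
Proof.
rewrite quot_liftE ?free_extE //; apply: tree_rels_ker.
- move=> U U' e; apply/ffunP=> I; rewrite !W_treeE.
  exact/esym/net_iso/e/tree_diagram.
- move=> U U' e; apply/ffunP=> I; rewrite ffunE !W_treeE ffunE.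
  exact/net_as/e/tree_diagram.
- move=> U U' U'' e; apply/ffunP=> I; rewrite ffunE [X in X + _]ffunE !W_treeE ffunE.
  by apply: net_ihx e; apply: valP.
Qed.

Lemma W_tree_relabel s T : W_tree (relabel s T) = tens_act s (W_tree T).
Proof.
rewrite tens_actE; apply/ffunP=> I; rewrite [RHS]ffunE !W_treeE /= /net.
apply: eq_bigr => x _; rewrite edges_conj ?tree_diagram //; last first.
  by case=> i; rewrite permE.
congr (_ * edges _ _); apply/ffunP=> -[i|p]; rewrite ffunE permE !ffunE //.
Qed.

Lemma Wh_equiv s (x : Cn n) : Wh n (Cn_act s x) = tens_act s (Wh n x).
Proof.
suff : (Wh n \o Cn_act s)%VF = (tens_act s \o Wh n)%VF.
  by move/lfunP/(_ x); rewrite !comp_lfunE.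
apply: Cn_eq => T; rewrite [LHS]comp_lfunE [RHS]comp_lfunE.
by rewrite (Cn_act_class s T) !Wh_class W_tree_relabel.
Qed.

Lemma InvP (t : tens n) :
  reflect (forall X I, sl2_act_fun X t I = 0) (t \in Inv n).
Proof.
rewrite memvE; apply: (iffP subv_bigcapP) => [tI X I|tI X _].
  have := tI X isT; rewrite -memvE memv_ker sl2_actE => /eqP/ffunP/(_ I) ->.
  by rewrite ffunE.
by rewrite -memvE memv_ker sl2_actE; apply/eqP/ffunP=> I; rewrite tI ffunE.
Qed.

Lemma W_tree_Inv T : W_tree T \in Inv n.
Proof.
apply/InvP=> X I; rewrite ffunE -[RHS](net_inv X I (tree_diagram T)).
by apply: eq_bigr => j _; apply: eq_bigr => y _; rewrite W_treeE.
Qed.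

Lemma limg_Wh_sub (L : {vspace tens n}) :
  (forall T, W_tree T \in L) -> (limg (Wh n) <= L)%VS.
Proof.
move=> TL; apply/subvP=> _ /memv_imgP[x _ ->].
have := memvf x; rewrite -quot_pi_surj => /memv_imgP[y _ ->].
rewrite (free_treeE y) !linear_sum; apply: memv_suml => T _.
rewrite !linearZ; apply: memvZ.
have /= -> := Wh_class T; exact: TL.
Qed.

Lemma W_tree_limg T : W_tree T \in limg (Wh n).
Proof. by rewrite -Wh_class memv_img ?memvf. Qed.

Lemma limg_stable s (t : tens n) : t \in limg (Wh n) -> tens_act s t \in limg (Wh n).
Proof. by case/memv_imgP=> x _ ->; rewrite -Wh_equiv memv_img ?memvf. Qed.

Lemma limg_Wh_Inv : (limg (Wh n) <= Inv n)%VS.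
Proof. exact/limg_Wh_sub/W_tree_Inv. Qed.

(** Otherwise the two legs of one edge would form a whole connected
    component. *)
Lemma tree_leg T (j : 'I_n) : (2 < n)%N -> exists p, val T (inl j) = inr p.
Proof.
move=> n2; case e : (val T (inl j)) => [i|p]; last by exists p.
have /and3P[dP /forallP cP _] := valP T.
have k0 : (0 < n.-2)%N by lia.
have /forallP/(_ (inr (Ordinal k0))) /connectP[p pP] := cP (inl j).
pose S : seq (vert n n.-2) := [:: inl j; inl i].
have Scl v w : v \in S -> adj (val T) v w -> w \in S.
  rewrite !inE => /orP[] /eqP -> /existsP[[h|//] /andP[/eqP[->] /eqP <-]].
    by rewrite e eqxx orbT.
  by rewrite -e diagK // eqxx.
have : inl j \in S by rewrite inE eqxx.
elim: p (inl j) pP => [|w q IH] v /= => [_ vS e'|/andP[vw qP] vS].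
  by move: vS; rewrite -e' !inE.
exact/IH/(Scl v).
Qed.

(** By pigeonhole two legs meet at the same vertex, where b has two equal
    arguments. *)
Lemma W_tree_h0 T : (2 < n)%N -> W_tree T (hword n) = 0.
Proof.
move=> n2; set d := val T.
have /fin_all_exists[f fE] : forall j, exists p, d (inl j) = inr p.
  by move=> j; exact: tree_leg.
have /injectivePn[i [j ij fij]] : ~~ injectiveb (fun j => (f j).1).
  apply/negP=> /injectiveP/leq_card; rewrite !card_ord; lia.
have f_inj : injective f.
  move=> a b e; apply: (@inl_inj _ ('I_n.-2 * 'I_3)%type); apply: (@perm_inj _ d).
  by rewrite !fE e.
have dP := tree_diagram T.
rewrite W_treeE; apply: big1 => x _.
have [xi|xi] := eqVneq (x (f i)) sl_h; last first.
  rewrite (edges_split _ (inl i)) // -/d fE /= !ffunE eq_sym (negPf xi).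
  by rewrite mul0r mulr0.
have [xj|xj] := eqVneq (x (f j)) sl_h; last first.
  rewrite (edges_split _ (inl j)) // -/d fE /= !ffunE eq_sym (negPf xj).
  by rewrite mul0r mulr0.
have fij2 : (f i).2 != (f j).2.
  apply: contraNneq ij => e2; apply/eqP/f_inj/eqP.
  by rewrite -pair_eqE /= e2 fij !eqxx.
rewrite (bigD1 (f i).1) //= vcoef_at.
have b_hh a : (b_coef sl_h sl_h a = 0) * (b_coef a sl_h sl_h = 0)
    * (b_coef sl_h a sl_h = 0).
  by case: a.
have : f j = nxt (f i) \/ f j = nxt (nxt (f i)).
  move: fij fij2; case: (f i) (f j) => v a [w b] /= <-; rewrite /nxt /=.
  case: (ord3P a); case: (ord3P b); rewrite !inord3S ?eqxx //;
    by [left|right].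
by case=> e; rewrite -e xi xj b_hh !mul0r.
Qed.

End WeightSystem.

(** * Grafting a cherry on a leg *)

(** The transpose of the bracket: the tensor b with its third index lowered
    by kappa. *)
Definition graft_coef (y a b : sl2_basis) : rat := \sum_z b_coef a b z * kappa z y.

Section Graft.
Variables n k : nat.
Local Notation H := (half n.+1 k).
Local Notation H' := (half n.+2 k.+1).
Implicit Types (d : {perm H}).

Definition leg1 : 'I_n.+2 := lift ord0 ord0.

(** The half-edges of the grafted diagram.  An old half-edge keeps its place,
    up to the shift of the numbers, except that leg 0 becomes the half-edge 2 of
    the new vertex 0.  The four others form two edges numbered by c: the boolean
    true selects the new leg, false its other half, at the new vertex. *)
Definition graft_half (z : H + bool * bool) : H' :=
  match z with
  | inl (inl i) => if unlift ord0 i is Some j then inl (lift ord0 i)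
                   else inr (ord0, inord 2)
  | inl (inr (v, a)) => inr (lift ord0 v, a)
  | inr (true, c) => inl (if c then leg1 else ord0)
  | inr (false, c) => inr (ord0, if c then inord 1 else inord 0)
  end.

Definition ungraft_half (h : H') : H + bool * bool :=
  match h with
  | inl i => if unlift ord0 i is Some i' then
               if i' == ord0 then inr (true, true) else inl (inl i')
             else inr (true, false)
  | inr (v, a) => if unlift ord0 v is Some v' then inl (inr (v', a))
                  else if a == inord 0 then inr (false, false)
                  else if a == inord 1 then inr (false, true)
                  else inl (inl ord0)
  end.

Lemma graft_halfK : cancel graft_half ungraft_half.
Proof.
case=> [[i|[v a]]|[[] []]] //=.
- by case: unliftP => [j ->|->] /=; rewrite ?liftK // unlift_none !inord3E.
- by rewrite liftK.
- by rewrite liftK eqxx.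
- by rewrite unlift_none.
- by rewrite unlift_none !inord3E eqxx.
- by rewrite unlift_none eqxx.
Qed.

Lemma ungraft_halfK : cancel ungraft_half graft_half.
Proof.
case=> [i|[v a]] /=.
- case: unliftP => [i' ->|->] //=.
  by case: eqP => [->|/eqP i0] //=; case: unliftP i0 => [//|->]; rewrite eqxx.
- case: unliftP => [v' ->|->] //=.
  by case: (ord3P a); rewrite ?eqxx ?inord3E //= unlift_none.
Qed.

Definition graft_sum d (z : H + bool * bool) : H + bool * bool :=
  match z with inl h => inl (d h) | inr (b, c) => inr (~~ b, c) end.

Lemma graft_sum_inj d : injective (graft_sum d).
Proof. by case=> [h|[[] []]] [h'|[[] []]] //= [/perm_inj->]. Qed.

Definition graft_fun d (h : H') := graft_half (graft_sum d (ungraft_half h)).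

Lemma graft_fun_inj d : injective (graft_fun d).
Proof.
apply: inj_comp (can_inj graft_halfK) _.
exact: inj_comp (@graft_sum_inj d) (can_inj ungraft_halfK).
Qed.

Definition graft_diag d : {perm H'} := perm (@graft_fun_inj d).

Lemma graft_diagE d z : graft_diag d (graft_half z) = graft_half (graft_sum d z).
Proof. by rewrite permE /graft_fun graft_halfK. Qed.

Lemma graft_is_diagram d : is_diagram d -> is_diagram (graft_diag d).
Proof.
move=> dP; apply/forallP=> h; rewrite -[h]ungraft_halfK; move: (ungraft_half h) => z.
rewrite !graft_diagE !(inj_eq (can_inj graft_halfK)); case: z => [z|[b c]] /=.
  by rewrite diagK // eqxx (inj_eq (@inl_inj _ _)) diag_neq.
by rewrite negbK eqxx; case: b.
Qed.

Definition graft_vert (v : vert n.+1 k) : vert n.+2 k.+1 :=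
  match v with
  | inl i => if unlift ord0 i is Some j then inl (lift ord0 i) else inr ord0
  | inr v => inr (lift ord0 v)
  end.

Lemma graft_vert_inj : injective graft_vert.
Proof.
case=> [i|v] [j|w] //=.
- case: unliftP => [i' ->|->]; case: unliftP => [j' ->|->] //.
  by move=> /eqP; rewrite (inj_eq (@inl_inj _ _)) (inj_eq lift_inj) => /eqP->.
- by case: (unlift ord0 i).
- by case: (unlift ord0 j).
- by move=> /eqP; rewrite (inj_eq (@inr_inj _ _)) (inj_eq lift_inj) => /eqP->.
Qed.

Lemma vtx_graft (h : H) : vtx (graft_half (inl h)) = graft_vert (vtx h).
Proof. by case: h => [i|[v a]] //=; case: unliftP. Qed.

(** A cycle that entered a leg could not leave it. *)
Lemma leg_dead d (c : seq H') (i : 'I_n.+2) (h : H') : is_diagram d ->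
  is_cycle (graft_diag d) c -> h \in c -> vtx h = inl i -> False.
Proof.
move=> dP /and3P[_ cc cu] hc vh.
have := next_cycle cc hc; have := prev_cycle cc hc.
rewrite /step => /andP[/eqP e1 /negP ne] _; apply: ne.
move: e1; rewrite vh; case: (h) vh => [?|?] //= [->].
by case: (graft_diag d _) => [?|?] //= [->].
Qed.

(** A cycle avoids the new legs, hence also the half-edges that lead to them;
    all the others come from the old diagram. *)
Lemma graft_is_acyclic d : is_diagram d -> is_acyclic d -> is_acyclic (graft_diag d).
Proof.
move=> dP /forallP dA; apply/forallP=> c; apply/negP=> cP.
have dead := leg_dead dP cP.
have /and3P[c0 cc cu] := cP.
have nospecial b e : graft_half (inr (b, e)) \notin c.
  apply/negP=> hc; case: b hc => hc; first exact: dead hc erefl.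
  have := next_cycle cc hc; rewrite /step graft_diagE => /andP[/eqP nE _].
  by apply: dead nE; rewrite mem_next.
pose un h := if ungraft_half h is inl h0 then h0 else inl ord0.
have unK : {in c, forall h, graft_half (inl (un h)) = h}.
  move=> h hc; rewrite /un; case e : (ungraft_half h) => [h0|[b f]].
    by rewrite -e ungraft_halfK.
  by have := nospecial b f; rewrite -e ungraft_halfK hc.
have cE : val c = map (fun h => graft_half (inl h)) (map un c).
  by rewrite -map_comp map_id_in.
set c' := map un c.
have cu' : uniq (map vtx c').
  rewrite -(map_inj_uniq graft_vert_inj) -map_comp.
  rewrite (eq_map (g := vtx \o (fun h => graft_half (inl h)))); last first.
    by move=> h /=; rewrite vtx_graft.
  by rewrite map_comp -cE.
have sz : (size c' <= n.+1 + k)%N.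
  rewrite -(size_map vtx) -(card_uniqP cu').
  by apply: leq_trans (max_card _) _; rewrite card_sum !card_ord.
have /negP[] := dA (Bseq sz); apply/and3P; split => //=.
- by rewrite /c' -size_eq0 size_map size_eq0.
- have sP h h' :
    step (graft_diag d) (graft_half (inl h)) (graft_half (inl h')) -> step d h h'.
    rewrite /step graft_diagE !vtx_graft.
    by rewrite (inj_eq graft_vert_inj) (inj_eq (can_inj graft_halfK)).
  by move: cc; rewrite cE cycle_map; apply: sub_cycle => h h'; apply: sP.
Qed.

Lemma graft_connect d v w : connect (adj d) v w ->
  connect (adj (graft_diag d)) (graft_vert v) (graft_vert w).
Proof.
case/connectP=> p pP ->; apply/connectP; exists (map graft_vert p); last by rewrite last_map.
rewrite path_map; apply: sub_path pP => x y /existsP[h /andP[/eqP<- /eqP<-]].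
apply/existsP; exists (graft_half (inl h)).
by rewrite graft_diagE /= !vtx_graft !eqxx.
Qed.

Lemma graft_is_connected d : is_connected d -> is_connected (graft_diag d).
Proof.
move=> /forallP cP; set d' := graft_diag d.
(* Every vertex is joined to the new one, both ways. *)
have c0 v : connect (adj d') v (graft_vert (inl ord0))
    * connect (adj d') (graft_vert (inl ord0)) v.
  have [[w ->]|[[b c] ->]] :
      (exists w, v = graft_vert w) \/ exists z, v = vtx (graft_half (inr z)).
    case: v => [i|v]; last first.
      case: (unliftP ord0 v) => [v' ->|->]; first by left; exists (inr v').
      by left; exists (inl ord0); rewrite /= unlift_none.
    case: (unliftP ord0 i) => [i' ->|->]; last by right; exists (true, false).
    case: (unliftP ord0 i') => [j ->|->]; last by right; exists (true, true).
    by left; exists (inl (lift ord0 j)); rewrite /= liftK.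
  - by split; apply: graft_connect; apply: (forallP (cP _)).
  have -> : graft_vert (inl ord0) = inr ord0 by rewrite /= unlift_none.
  case: b => /=; last by split; exact: connect0.
  split; apply: connect1; apply/existsP.
    by exists (graft_half (inr (true, c))); rewrite /d' graft_diagE /= !eqxx.
  by exists (graft_half (inr (false, c))); rewrite /d' graft_diagE /= !eqxx.
apply/forallP=> v; apply/forallP=> w.
exact: connect_trans (c0 v).1 (c0 w).2.
Qed.

Lemma graft_is_tree d : is_tree d -> is_tree (graft_diag d).
Proof.
case/and3P=> dP dC dA; apply/and3P; split.
- exact: graft_is_diagram.
- exact: graft_is_connected.
- exact: graft_is_acyclic.
Qed.

(** The labels at the new vertex 0, and those at the old vertices. *)
Definition cons_vertex
    (z : sl2_basis * sl2_basis * sl2_basis * {ffun 'I_k * 'I_3 -> sl2_basis}) :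
    {ffun 'I_k.+1 * 'I_3 -> sl2_basis} :=
  [ffun p => if unlift ord0 p.1 is Some v then z.2 (v, p.2) else
     if p.2 == inord 0 then z.1.1.1 else if p.2 == inord 1 then z.1.1.2 else z.1.2].

Lemma cons_vertex_bij : bijective cons_vertex.
Proof.
exists (fun x : {ffun 'I_k.+1 * 'I_3 -> sl2_basis} => 
   (x (ord0, inord 0), x (ord0, inord 1), x (ord0, inord 2),
   [ffun p : 'I_k * 'I_3 => x (lift ord0 p.1, p.2)])).
- move=> [[[a b] c] x]; rewrite !ffunE /= unlift_none eqxx !inord3E eqxx; congr (_, _).
  by apply/ffunP=> -[v i]; rewrite !ffunE /= liftK.
- move=> x; apply/ffunP=> -[v i]; rewrite !ffunE /=.
  case: unliftP => [v' ->|->]; first by rewrite ffunE.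
  by case: (ord3P i); rewrite ?inord3E ?eqxx.
Qed.

Local Arguments graft_half : simpl never.

(** The old edge of leg 0 now starts at a trivalent half-edge.  Contracting the
    label y of this leg with kappa accounts for that: kappa and c are inverse to
    each other, and kappa applied to an identity coefficient is kappa. *)
Lemma graft_edges d (I : word n.+2) a b z x : is_diagram d ->
  edges (graft_diag d) (lab I (cons_vertex (a, b, z, x))) =
  (I ord0 == a)%:R * (I leg1 == b)%:R *
  \sum_y kappa z y * edges d (lab (set_factor [ffun i => I (lift ord0 i)] ord0 y) x).
Proof.
move=> dP; have d'P := graft_is_diagram dP; set l := lab _ _.
pose o (z : H + bool * bool) := match z with inl h => orient d h | inr (b, c) => b end.
pose F (h : H') := edge_coef h (graft_diag d h) (l h) (l (graft_diag d h)).
have FE h : F (graft_diag d h) = F h by exact: edge_coef_diag.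
have F'd h : F (graft_half (inl (d h))) = F (graft_half (inl h)).
  by rewrite -FE graft_diagE /= diagK.
rewrite {1}/edges (prod_orient (d := graft_diag d) (o' := o \o ungraft_half)) //; last 2 first.
- by move=> h; exact: orientP.
- move=> h; rewrite -[h]ungraft_halfK graft_diagE /= !graft_halfK.
  by case: (ungraft_half h) => [h0|[[] c]] //=; rewrite orientP.
rewrite -/F (reindex graft_half) /=; last first.
  by apply: onW_bij; exists ungraft_half; [exact: graft_halfK | exact: ungraft_halfK].
under eq_bigl do rewrite graft_halfK.
rewrite big_sumType /= mulrC; congr (_ * _).
  have Fs c : F (graft_half (inr (true, c))) =
      (I (if c then leg1 else ord0) == if c then b else a)%:R.
    rewrite /F graft_diagE /graft_half /= !ffunE /= unlift_none.
    by case: c; rewrite ?inord3E ?eqxx.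
  rewrite mulrC (bigD1 (true, true)) // (big_pred1 (true, false)); last by case=> [[] []].
  exact: (congr2 *%R (Fs true) (Fs false)).
pose J y : word n.+1 := set_factor [ffun i => I (lift ord0 i)] ord0 y.
(* Only at leg 0 do the old and the new diagram differ. *)
have lE y h : h != inl ord0 -> l (graft_half (inl h)) = lab (J y) x h.
  case: h => [i|[v e]] hN; rewrite /graft_half !ffunE /=; last by rewrite liftK.
  case: unliftP hN => [i' ->|->]; last by rewrite eqxx.
  by [].
have legE h : h != inl ord0 -> is_leg (graft_half (inl h)) = is_leg h.
  case: h => [j|[v e]] //=; rewrite /graft_half /=.
  by case: unliftP => [i' ->|->] //; rewrite eqxx.
have d0 : d (inl ord0) != inl ord0 by rewrite diag_neq.
rewrite (prod_orient_split (fun h => diagK h dP) (inl ord0)) //; last first.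
  by move=> h; exact: orientP.
set R := \prod_(_ | _) _.
have ER y : edges d (lab (J y) x) =
    edge_coef (inl ord0) (d (inl ord0)) y (l (graft_half (inl (d (inl ord0))))) * R.
  rewrite (edges_split _ (inl ord0)) // -(lE y (d (inl ord0))) //.
  congr (edge_coef _ _ _ _ * _).
    by rewrite !ffunE eqxx.
  apply: eq_bigr => h /andP[_ /andP[h0 hd0]].
  have dh0 : d h != inl ord0 by apply: contraNneq hd0 => <-; rewrite diagK.
  rewrite /F graft_diagE -!(lE y) //.
  by apply: edge_coef_leg; rewrite legE.
under eq_bigr do rewrite ER mulrA.
rewrite -mulr_suml; congr (_ * _).
rewrite /F graft_diagE; set c := l (graft_half (inl (d _))).
have -> : l (graft_half (inl (inl ord0))) = z.
  by rewrite /graft_half /= unlift_none !ffunE /= unlift_none !inord3E.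
rewrite /graft_half /= unlift_none.
case e : (d (inl ord0)) d0 => [i|[v g]] /=.
  by case: unliftP => [i' _ _|->]; [rewrite kappa_cK | rewrite eqxx].
move=> _; rewrite (bigD1 c) //= eqxx mulr1 big1 ?addr0 // => y yc.
by rewrite (negPf yc) mulr0.
Qed.

Lemma prod_vcoef_cons a b z x :
  \prod_v vcoef (cons_vertex (a, b, z, x)) v = b_coef a b z * \prod_v vcoef x v.
Proof.
rewrite big_ord_recl /vcoef !ffunE /= unlift_none eqxx !inord3E eqxx.
by congr (_ * _); apply: eq_bigr => v _; rewrite !ffunE /= liftK.
Qed.

Lemma sum_delta (R : pzSemiRingType) (T : finType) (c : T) (G : T -> R) :
  \sum_a (c == a)%:R * G a = G c.
Proof.
rewrite (bigD1 c) //= eqxx mul1r big1 ?addr0 // => a; rewrite eq_sym => /negPf->.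
by rewrite mul0r.
Qed.

Lemma net_graft d I : is_diagram d ->
  net (graft_diag d) I = \sum_y graft_coef y (I ord0) (I leg1) *
     net d (set_factor [ffun i => I (lift ord0 i)] ord0 y).
Proof.
move=> dP; set J := set_factor _ _.
transitivity (\sum_a (I ord0 == a)%:R * \sum_b (I leg1 == b)%:R *
    \sum_z \sum_x b_coef a b z * (\prod_v vcoef x v) *
      \sum_y kappa z y * edges d (lab (J y) x)).
  under eq_bigr do rewrite mulr_sumr.
  under eq_bigr do under eq_bigr do rewrite mulrA mulr_sumr.
  under eq_bigr do under eq_bigr do under eq_bigr do rewrite mulr_sumr.
  rewrite pair_bigA pair_bigA pair_bigA /net (reindex cons_vertex) /=; last first.
    exact/onW_bij/cons_vertex_bij.
  apply: eq_bigr => -[[[a b] z] x] _.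
  by rewrite prod_vcoef_cons graft_edges //= -/J mulrCA.
rewrite !sum_delta.
transitivity (\sum_z \sum_x \sum_y b_coef (I ord0) (I leg1) z * kappa z y *
   (\prod_v vcoef x v * edges d (lab (J y) x))).
  apply: eq_bigr => z _; apply: eq_bigr => x _; rewrite mulr_sumr.
  by apply: eq_bigr => y _; rewrite -!mulrA; congr (_ * _); rewrite mulrCA.
under [RHS]eq_bigr do rewrite /graft_coef mulr_suml.
rewrite [RHS]exchange_big; apply: eq_bigr => z _.
rewrite exchange_big; apply: eq_bigr => y _.
by rewrite /net mulr_sumr.
Qed.

End Graft.

Definition graft_tree m (T : tree m.+2) : tree m.+3 :=
  exist (fun d => is_tree d) _ (graft_is_tree (valP T)).

(** * Grafting and bracketing tensors *)

Lemma linfun_linearE (K : fieldType) (V W : vectType K) (f : V -> W) :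
  linear f -> linfun f =1 f.
Proof.
move=> lin; pose L := GRing.isLinear.Build _ _ _ _ _ lin.
pose g : {linear V -> W} := HB.pack f L.
exact: (lfunE g).
Qed.

Lemma tens_lin n m (f : tens n -> tens m) :
  (forall a t u I, f (a *: t + u) I = a * f t I + f u I) -> linear f.
Proof. by move=> H a t u; apply/ffunP=> I; rewrite H !ffunE. Qed.

Section Words.
Variable n : nat.

Definition wtail (I : word n.+1) : word n := [ffun i => I (lift ord0 i)].
Definition wcons (y : sl2_basis) (J : word n) : word n.+1 :=
  [ffun i => if unlift ord0 i is Some j then J j else y].

Lemma wcons0 y J : wcons y J ord0 = y.
Proof. by rewrite ffunE unlift_none. Qed.

Lemma wconsS y J i : wcons y J (lift ord0 i) = J i.
Proof. by rewrite ffunE liftK. Qed.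

Lemma wtailK y J : wtail (wcons y J) = J.
Proof. by apply/ffunP=> i; rewrite ffunE wconsS. Qed.

Lemma wcons_eta (I : word n.+1) : I = wcons (I ord0) (wtail I).
Proof. by apply/ffunP=> i; rewrite ffunE; case: unliftP => [j ->|->] //; rewrite ffunE. Qed.

Lemma set_factor_wcons0 a y J : set_factor (wcons a J) ord0 y = wcons y J.
Proof. by apply/ffunP=> i; rewrite !ffunE; case: unliftP => [j ->|->]. Qed.

Lemma set_factor_wconsS a y J j :
  set_factor (wcons a J) (lift ord0 j) y = wcons a (set_factor J j y).
Proof.
apply/ffunP=> i; rewrite !ffunE; case: unliftP => [k ->|->] //.
by rewrite ffunE (inj_eq lift_inj).
Qed.

Lemma set_factor_tail (I : word n.+1) y : set_factor I ord0 y = wcons y (wtail I).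
Proof. by rewrite [I in LHS]wcons_eta set_factor_wcons0. Qed.

(** All operations below affect the first factors only; this splits the action
    accordingly. *)
Lemma act_wcons X (t : tens n.+1) a J : sl2_act_fun X t (wcons a J) =
  \sum_y sl2_bracket X y a * t (wcons y J) +
  \sum_j \sum_y sl2_bracket X y (J j) * t (wcons a (set_factor J j y)).
Proof.
rewrite ffunE big_ord_recl wcons0; congr (_ + _).
  by apply: eq_bigr => y _; rewrite set_factor_wcons0.
apply: eq_bigr => j _; rewrite wconsS; apply: eq_bigr => y _.
by rewrite set_factor_wconsS.
Qed.

End Words.

Lemma Inv_wcons n (t : tens n.+1) : (forall X a J, sl2_act_fun X t (wcons a J) = 0) ->
  t \in Inv n.+1.
Proof. by move=> H; apply/InvP=> X I; rewrite (wcons_eta I). Qed.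

Section GraftTensor.
Variable n : nat.

(** The first factor is replaced by the transpose of the bracket, with values in
    the first two factors. *)
Definition graft_fun_tens (t : tens n.+1) : tens n.+2 :=
  [ffun I : word n.+2 => \sum_y graft_coef y (I ord0) (I (leg1 n)) *
     t (wcons y (wtail (wtail I)))].

Definition graft_tens : 'Hom(tens n.+1, tens n.+2) := linfun graft_fun_tens.

Lemma graft_tensE t : graft_tens t = graft_fun_tens t.
Proof.
apply: linfun_linearE; apply: tens_lin => a u v I; rewrite !ffunE mulr_sumr -big_split /=.
by apply: eq_bigr => y _; rewrite !ffunE mulrDr mulrCA.
Qed.

Lemma graft_tens_wcons t a b K : graft_tens t (wcons a (wcons b K)) =
  \sum_y graft_coef y a b * t (wcons y K).
Proof. by rewrite graft_tensE ffunE wcons0 wconsS wcons0 !wtailK. Qed.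

(** The bracket of the first two factors, normalised to be inverse to
    [graft_tens] on antisymmetric tensors. *)
Definition bracket_tens (t : tens n.+2) : tens n.+1 :=
  [ffun J : word n.+1 => 2^-1 * \sum_a \sum_b sl2_bracket a b (J ord0) *
     t (wcons a (wcons b (wtail J)))].

(** The Jacobi identity: the bracket is a morphism of sl_2-modules. *)
Lemma bracket_equiv X c (f : sl2_basis -> sl2_basis -> rat) :
  \sum_y sl2_bracket X y c * (2^-1 * \sum_a \sum_b sl2_bracket a b y * f a b) =
  2^-1 * \sum_a \sum_b sl2_bracket a b c *
     (\sum_y sl2_bracket X y a * f y b + \sum_y sl2_bracket X y b * f a y).
Proof. by rewrite !sum_sl2; case: X; case: c => /=; field. Qed.

Lemma exchange_quad (R : comPzSemiRingType) (T1 T2 T3 T4 : finType)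
    (G : T1 -> T2 -> R) (A : T3 -> T4 -> R) (F : T1 -> T2 -> T3 -> T4 -> R) :
  \sum_a \sum_b G a b * (\sum_j \sum_y A j y * F a b j y) =
  \sum_j \sum_y A j y * (\sum_a \sum_b G a b * F a b j y).
Proof.
rewrite pair_bigA [RHS]pair_bigA.
under eq_bigr do rewrite pair_bigA mulr_sumr.
under [RHS]eq_bigr do rewrite pair_bigA mulr_sumr.
rewrite exchange_big; apply: eq_bigr => p _; apply: eq_bigr => q _.
by rewrite mulrCA.
Qed.

Lemma bracket_Inv t : t \in Inv n.+2 -> bracket_tens t \in Inv n.+1.
Proof.
move=> /InvP tI; apply: Inv_wcons => X c K; rewrite act_wcons.
under eq_bigr do rewrite ffunE wcons0 wtailK.
rewrite (bracket_equiv X c (fun a b => t (wcons a (wcons b K)))).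
transitivity (2^-1 * \sum_a \sum_b sl2_bracket a b c * sl2_act_fun X t (wcons a (wcons b K))).
  under [X in _ + X]eq_bigr do under eq_bigr do rewrite ffunE wcons0 wtailK mulrCA.
  under [X in _ + X]eq_bigr do rewrite -mulr_sumr.
  rewrite -mulr_sumr -mulrDr; congr (_ * _).
  rewrite -(exchange_quad (fun a b => sl2_bracket a b c) (fun j y => sl2_bracket X y (K j))
    (fun a b j y => t (wcons a (wcons b (set_factor K j y))))) -big_split.
  apply: eq_bigr => a _; rewrite -big_split; apply: eq_bigr => b _ /=.
  rewrite act_wcons big_ord_recl wcons0 addrA -mulrDr; congr (_ * (_ + _ + _)).
    by apply: eq_bigr => y _; rewrite set_factor_wcons0.
  apply: eq_bigr => j _; apply: eq_bigr => y _.
  by rewrite wconsS set_factor_wconsS.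
rewrite big1 ?mulr0 // => a _; rewrite big1 // => b _.
by rewrite tI mulr0.
Qed.

(** The bracket identifies the exterior square of sl_2 with sl_2. *)
Lemma graft_bracket a b (f : sl2_basis -> sl2_basis -> rat) :
  \sum_y graft_coef y a b * (2^-1 * \sum_a' \sum_b' sl2_bracket a' b' y * f a' b') =
  f a b - f b a.
Proof.
by rewrite /graft_coef !sum_sl2; case: a; case: b => /=; field.
Qed.

Lemma perm01_wcons a b (K : word n) :
  [ffun j => wcons a (wcons b K) (tperm ord0 (leg1 n) j)] = wcons b (wcons a K).
Proof.
apply/ffunP=> i; rewrite ffunE; case: (unliftP ord0 i) => [i' ->|->]; last first.
  by rewrite tpermL wconsS !wcons0.
case: (unliftP ord0 i') => [i'' ->|->]; last by rewrite tpermR wconsS !wcons0.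
by rewrite tpermD ?(inj_eq lift_inj) // !wconsS.
Qed.

Lemma antisym_graft t : t - tens_act (tperm ord0 (leg1 n)) t = graft_tens (bracket_tens t).
Proof.
apply/ffunP=> I; rewrite (wcons_eta I) (wcons_eta (wtail I)).
move: (I _) (wtail I _) (wtail (wtail I)) => a b K.
rewrite graft_tens_wcons tens_actE !ffunE perm01_wcons.
under eq_bigr do rewrite ffunE wcons0 wtailK.
by rewrite (graft_bracket a b (fun a b => t (wcons a (wcons b K)))).
Qed.

End GraftTensor.

Arguments graft_tens {n}.

(** * Symmetric invariant tensors *)

Section SymmetricInvariants.
Variable n : nat.
Implicit Types (I J : word n) (t : tens n).

Definition count_factor (y : sl2_basis) I : nat := (\sum_j (I j == y))%N.

Lemma count_factor_del y z I j : I j = y -> z != y ->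
  count_factor y I = (count_factor y (set_factor I j z)).+1.
Proof.
move=> Ij zy; rewrite /count_factor (bigD1 j) //= [in RHS](bigD1 j) //= ffunE Ij !eqxx.
rewrite (negPf zy) add0n add1n; congr _.+1.
by apply: eq_bigr => i ij; rewrite ffunE (negPf ij).
Qed.

Lemma count_factor_other y z I j : I j != y -> z != y ->
  count_factor y (set_factor I j z) = count_factor y I.
Proof.
move=> Ij zy; apply: eq_bigr => i _; rewrite ffunE; case: (i =P j) => [->|//].
by rewrite (negPf zy) (negPf Ij).
Qed.

Lemma count_factor_gt0 y I : (0 < count_factor y I)%N -> exists j, I j = y.
Proof.
rewrite lt0n sum_nat_eq0 => /forallPn[j]; rewrite eqb0 negbK => /eqP Ij.
by exists j.
Qed.

Lemma count_factor_sum I :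
  (count_factor sl_h I + count_factor sl_e I + count_factor sl_f I)%N = n.
Proof.
rewrite -!big_split /= -[RHS]card_ord -sum1_card; apply: eq_bigr => j _.
by case: (I j); rewrite ?eqxx ?sl2_eqE.
Qed.

Lemma count_factorE y I (c : rat) : \sum_(j | I j == y) c = c *+ count_factor y I.
Proof.
rewrite /count_factor -mulr_natr natr_sum mulr_sumr big_mkcond.
by apply: eq_bigr => j _; case: eqP; rewrite ?mulr1 ?mulr0.
Qed.

(** h acts on a basis tensor by twice the difference of the two numbers. *)
Lemma Inv_weight t I : t \in Inv n -> count_factor sl_e I != count_factor sl_f I ->
  t I = 0.
Proof.
move/InvP/(_ sl_h I); rewrite ffunE => act0 ne.
have E j : \sum_y sl2_bracket sl_h y (I j) * t (set_factor I j y) =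
    2 * (I j == sl_e)%:R * t I - 2 * (I j == sl_f)%:R * t I.
  have tE y : I j = y -> t (set_factor I j y) = t I.
    by move=> <-; congr (t _); apply/ffunP=> i; rewrite ffunE; case: eqP => // ->.
  rewrite sum_sl2; case e : (I j); rewrite ?eqxx ?sl2_eqE /= ?(tE _ e); ring.
move: act0; under eq_bigr do rewrite E.
rewrite sumrB -!mulr_suml -!mulr_sumr -!natr_sum -mulrBl -mulrBr => /eqP.
rewrite !mulf_eq0 subr_eq0 eqr_nat (negPf ne) orbF /=.
by move/eqP.
Qed.

Definition symmetric_tens t := forall s : 'S_n, tens_act s t = t.

Lemma symmetric_set_factor t I y i j : symmetric_tens t -> I i = I j ->
  t (set_factor I i y) = t (set_factor I j y).
Proof.
move=> /(_ (tperm i j)) ts e; rewrite -{1}ts tens_actE ffunE; congr (t _).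
apply/ffunP=> k; rewrite !ffunE; case: (tpermP i j k) => [->|->|/eqP ki /eqP kj].
- by rewrite eq_sym e.
- by rewrite !eqxx.
- by rewrite (negPf ki) (negPf kj).
Qed.

(** The coefficient at I of e . t = 0: on the coefficients of t, e turns a
    factor e into h with coefficient - 2, and a factor h into f. *)
Lemma Inv_e t I : t \in Inv n ->
  2 * \sum_(j | I j == sl_e) t (set_factor I j sl_h) =
  \sum_(j | I j == sl_h) t (set_factor I j sl_f).
Proof.
move/InvP/(_ sl_e I); rewrite ffunE => act0; apply/esym/eqP; rewrite -subr_eq0.
rewrite -[eqbRHS]act0 big_mkcond [X in 2 * X]big_mkcond mulr_sumr -sumrB; apply/eqP.
apply: eq_bigr => j _; rewrite sum_sl2; case: (I j); rewrite ?eqxx ?sl2_eqE /=; ring.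
Qed.

(** All terms on each side of [Inv_e] are equal when t is symmetric, so that the
    vanishing of one side gives that of any term of the other. *)
Lemma symmetric_Inv_up t I j : t \in Inv n -> symmetric_tens t -> I j = sl_h ->
  (forall i, I i = sl_e -> t (set_factor I i sl_h) = 0) -> t (set_factor I j sl_f) = 0.
Proof.
move=> tI ts Ij H; have := Inv_e I tI.
rewrite big1 => [|i /eqP/H //]; rewrite mulr0.
under eq_bigr => i /eqP Ii do rewrite (symmetric_set_factor _ ts (etrans Ii (esym Ij))).
rewrite count_factorE => /esym/eqP; rewrite mulrn_eq0 => /orP[|/eqP //].
by rewrite (count_factor_del Ij (z := sl_f)) ?sl2_eqE.
Qed.

Lemma symmetric_Inv_down t I j : t \in Inv n -> symmetric_tens t -> I j = sl_e ->
  (forall i, I i = sl_h -> t (set_factor I i sl_f) = 0) -> t (set_factor I j sl_h) = 0.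
Proof.
move=> tI ts Ij H; have := Inv_e I tI.
rewrite [RHS]big1 => [|i /eqP/H //].
under eq_bigr => i /eqP Ii do rewrite (symmetric_set_factor _ ts (etrans Ii (esym Ij))).
rewrite count_factorE => /eqP; rewrite mulf_eq0 orFb mulrn_eq0 => /orP[|/eqP //].
by rewrite (count_factor_del Ij (z := sl_h)) ?sl2_eqE.
Qed.

(** A symmetric invariant is determined by one coefficient, the powers of the
    Casimir element being the only invariant polynomials.  By weight, e and f
    occur equally often in a word with nonzero coefficient; the induction is on
    this number, [symmetric_Inv_up] exchanging one e and one f for two h. *)
Lemma symmetric_Inv_eq0 t : t \in Inv n -> symmetric_tens t -> t (hword n) = 0 -> t = 0.
Proof.
move=> tI ts t0; apply/ffunP=> I; rewrite [RHS]ffunE.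
have [m cm] : exists m, count_factor sl_f I = m by eexists.
elim: m I cm => [|m IH] I cm.
  have [ce|ne] := eqVneq (count_factor sl_e I) (count_factor sl_f I); last exact: Inv_weight.
  suff -> : I = hword n by [].
  apply/ffunP=> j; rewrite ffunE; case e : (I j) => //.
    by have := count_factor_del (z := sl_h) e; rewrite ce cm sl2_eqE => /(_ isT).
  by have := count_factor_del (z := sl_h) e; rewrite cm sl2_eqE => /(_ isT).
have [j Ij] : exists j, I j = sl_f by apply: count_factor_gt0; rewrite cm.
have IE : I = set_factor (set_factor I j sl_h) j sl_f.
  by apply/ffunP=> i; rewrite !ffunE; case: eqP => // ->.
have := count_factor_del (z := sl_h) Ij; rewrite cm sl2_eqE => /(_ isT)[cj].
rewrite IE; apply: symmetric_Inv_up => // [|i Ii]; first by rewrite ffunE eqxx.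
by apply: IH; rewrite count_factor_other ?Ii ?sl2_eqE.
Qed.

(** For n odd the recurrence of [symmetric_Inv_down] starts from words with a
    single h, for which the terms with fewer h do not exist. *)
Lemma symmetric_Inv_odd t : odd n -> t \in Inv n -> symmetric_tens t -> t (hword n) = 0.
Proof.
move=> n_odd tI ts; move: (hword n) => I.
have [m] := ubnP (count_factor sl_h I); elim: m I => // m IH I cm.
have [ce|ne] := eqVneq (count_factor sl_e I) (count_factor sl_f I); last exact: Inv_weight.
have [j Ij] : exists j, I j = sl_h.
  apply: count_factor_gt0; rewrite lt0n; apply: contraTneq n_odd => c0.
  by rewrite -(count_factor_sum I) c0 ce add0n addnn odd_double.
have IE : I = set_factor (set_factor I j sl_e) j sl_h.
  by apply/ffunP=> i; rewrite !ffunE; case: eqP => // ->.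
rewrite IE; apply: symmetric_Inv_down => // [|i Ii]; first by rewrite ffunE eqxx.
have cj := count_factor_del (z := sl_e) Ij; rewrite sl2_eqE in cj.
have ci := count_factor_del (z := sl_f) Ii; rewrite sl2_eqE in ci.
apply: IH; have := cj isT; have := ci isT; lia.
Qed.

End SymmetricInvariants.

(** * Averaging over the symmetric group *)

Section Averaging.
Variable n : nat.
Implicit Types (t : tens n) (s : 'S_n).

Lemma tens_act_Inv s t : t \in Inv n -> tens_act s t \in Inv n.
Proof. by move=> tI; apply: (subvP (Inv_stable s)); apply: memv_img. Qed.

Lemma tens_act_hword s t : tens_act s t (hword n) = t (hword n).
Proof. by rewrite tens_actE ffunE; congr (t _); apply/ffunP=> j; rewrite !ffunE. Qed.

Lemma tens_actMv s s' t : tens_act (s * s')%g t = tens_act s' (tens_act s t).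
Proof. by rewrite tens_actM comp_lfunE. Qed.

Definition average t := \sum_(s : 'S_n) tens_act s t.

Lemma average_symmetric t : symmetric_tens (average t).
Proof.
move=> s; rewrite linear_sum [RHS](reindex_inj (mulIg s)) /=.
by apply: eq_bigr => s' _; rewrite tens_actMv.
Qed.

Lemma average_Inv t : t \in Inv n -> average t \in Inv n.
Proof. by move=> tI; apply: memv_suml => s _; apply: tens_act_Inv. Qed.

Lemma card_Sn_gt0 : (0 < #|{: 'S_n}|)%N.
Proof. by apply/card_gt0P; exists 1%g. Qed.

Lemma average_hword t : average t (hword n) = t (hword n) *+ #|{: 'S_n}|.
Proof.
rewrite sum_ffunE -sumr_const; apply: eq_bigr => s _; exact: tens_act_hword.
Qed.

Lemma Inv_odd_hword t : odd n -> t \in Inv n -> t (hword n) = 0.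
Proof.
move=> n_odd tI; have := symmetric_Inv_odd n_odd (average_Inv tI) (@average_symmetric t).
rewrite average_hword => /eqP; rewrite mulrn_eq0 => /orP[|/eqP //].
by rewrite eqn0Ngt card_Sn_gt0.
Qed.

(** Modulo L, t is proportional to its average, which is zero by
    [symmetric_Inv_eq0]. *)
Lemma Inv_average_sub (L : {vspace tens n}) :
  (forall s t, t \in Inv n -> t - tens_act s t \in L) ->
  forall t, t \in Inv n -> t (hword n) = 0 -> t \in L.
Proof.
move=> Lsub t tI t0.
have a0 : average t = 0.
  apply: symmetric_Inv_eq0; [exact: average_Inv | exact: average_symmetric |].
  by rewrite average_hword t0 mul0rn.
have : t *+ #|{: 'S_n}| \in L.
  rewrite -[X in X \in L]subr0 -[X in _ - X]a0 -sumr_const -sumrB.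
  by apply: memv_suml => s _; apply: Lsub.
rewrite -scaler_nat => tL; have := memvZ (#|{: 'S_n}|%:R^-1 : rat) tL.
by rewrite scalerA mulVf ?scale1r // pnatr_eq0 -lt0n card_Sn_gt0.
Qed.

End Averaging.

Lemma tperm_conj01 n (i j : 'I_n.+2) : i != j ->
  exists s : 'S_n.+2, tperm i j = (tperm ord0 (leg1 n) ^ s)%g.
Proof.
move=> ij; pose j' := tperm ord0 i j.
exists (tperm (leg1 n) j' * tperm ord0 i)%g.
have j'0 : j' != ord0.
  by apply: contraNneq ij => e; rewrite -(tpermK ord0 i j) -/j' e tpermL.
rewrite tpermJ !permM tpermL; congr (tperm _ _); last by rewrite /j' tpermK.
by rewrite [tperm _ j' _]tpermD ?tpermL.
Qed.

(** By [antisym_graft], t is congruent to (0 1) t modulo the grafts; conjugation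
    gives all transpositions, and these generate. *)
Lemma Inv_graft_sub n (L : {vspace tens n.+2}) :
  (forall s t, t \in L -> tens_act s t \in L) ->
  (forall t, t \in Inv n.+1 -> graft_tens t \in L) ->
  forall t, t \in Inv n.+2 -> t (hword n.+2) = 0 -> t \in L.
Proof.
move=> Lact Lgraft; apply: Inv_average_sub => s.
have [ts -> dts] := prod_tpermP s; elim: ts dts => [_ t _|[i j] ts IH /andP[/= ij dts] t tI].
  by rewrite big_nil tens_act1 id_lfunE subrr mem0v.
rewrite big_cons tens_actMv /=.
set u := tens_act (tperm i j) t.
rewrite -(subrK u t) -addrA; apply: memvD; last first.
  by apply: IH => //; apply: tens_act_Inv.
have [r e] := tperm_conj01 ij; pose v := tens_act (r^-1)%g t.
have -> : t - u = tens_act r (v - tens_act (tperm ord0 (leg1 n)) v).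
  rewrite linearB /= -!tens_actMv mulVg tens_act1 id_lfunE /u e.
  by rewrite conjgE.
by apply: Lact; rewrite antisym_graft; apply/Lgraft/bracket_Inv/tens_act_Inv.
Qed.

(** * The image of the weight system *)

Lemma graft_tens_W m (T : tree m.+2) : graft_tens (W_tree T) = W_tree (graft_tree T).
Proof.
rewrite graft_tensE; apply/ffunP=> I; rewrite ffunE W_treeE net_graft ?tree_diagram //.
by apply: eq_bigr => y _; rewrite W_treeE -set_factor_tail.
Qed.

Lemma graft_limg m t : t \in limg (Wh m.+2) -> graft_tens t \in limg (Wh m.+3).
Proof.
move=> tL; rewrite memv_preim; move: t tL; apply/subvP/limg_Wh_sub => T.
by rewrite -memv_preim graft_tens_W W_tree_limg.
Qed.

(** With two legs and no other half-edge, the only diagram is the transposition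
    of the legs. *)
Definition strut_diag : {perm half 2 0} := label_perm 0 (tperm ord0 ord_max).

Lemma strut_diagE j : strut_diag (inl j) = inl (tperm ord0 ord_max j).
Proof. by rewrite permE. Qed.

Lemma strut_is_tree : is_tree strut_diag.
Proof.
have no_tri (p : 'I_0 * 'I_3) : False by case: p => -[].
apply/and3P; split.
- apply/forallP=> -[j|p]; last by case: (no_tri p).
  rewrite !strut_diagE tpermK eqxx (inj_eq (@inl_inj _ _)) /=.
  case: (tpermP ord0 ord_max j) => [->|->|/eqP j0 /eqP j1] //.
  by case: j j0 j1 => -[|[|//]].
- apply/forallP=> -[i|[]//]; apply/forallP=> -[j|[]//].
  have [->|ij] := eqVneq i j; first exact: connect0.
  apply/connect1/existsP; exists (inl i); rewrite strut_diagE /= eqxx.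
  rewrite (inj_eq (@inl_inj _ _)).
  case: (tpermP ord0 ord_max i) ij => [->|->|/eqP i0 /eqP i1 _].
  - by case: j => -[|[|//]].
  - by case: j => -[|[|//]].
  - by case: i i0 i1 => -[|[|//]].
apply/forallP=> c; apply/negP=> /and3P[c0 cc _].
case: c c0 cc => -[//|h q] sz _ cc; have hc : h \in h :: q by rewrite inE eqxx.
have := next_cycle cc hc; rewrite /step => /andP[/eqP e /negP[]]; move: e.
case: h {hc cc sz} (next _ _) => [i|p] [j|p2]; try by [case: (no_tri p)|case: (no_tri p2)].
by rewrite strut_diagE /= => -[->].
Qed.

Definition strut : tree 2 := exist (fun d => is_tree d) _ strut_is_tree.

Lemma W_strut_hword : W_tree strut (hword 2) != 0.
Proof.
rewrite W_treeE /net; apply/eqP=> W0.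
have pos (x : {ffun 'I_0 * 'I_3 -> sl2_basis}) :
    0 < (\prod_v vcoef x v) * edges strut_diag (lab (hword 2) x).
  rewrite big_ord0 mul1r; apply: prodr_gt0 => -[i|[[]//]] _.
  by rewrite strut_diagE /= !ffunE.
suff : 0 < \sum_x (\prod_v vcoef x v) * edges strut_diag (lab (hword 2) x) by rewrite W0.
rewrite (bigD1 [ffun=> sl_h]) //=; apply: ltr_wpDr; last exact: pos.
by apply: sumr_ge0 => x _; apply/ltW/pos.
Qed.

Section Products.
Variable n : nat.

Definition c_tens (t : tens n) : tens n.+2 :=
  [ffun I : word n.+2 => c_coef (I ord0) (I (leg1 n)) * t (wtail (wtail I))].

Lemma c_tens_wcons t a b K : c_tens t (wcons a (wcons b K)) = c_coef a b * t K.
Proof. by rewrite ffunE wcons0 wconsS wcons0 !wtailK. Qed.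

Lemma c_tens_Inv t : t \in Inv n -> c_tens t \in Inv n.+2.
Proof.
move=> /InvP tI; apply: Inv_wcons => X a J; rewrite (wcons_eta J).
move: (J _) (wtail J) => b K {J}.
rewrite act_wcons big_ord_recl wcons0 addrA.
under eq_bigr do rewrite c_tens_wcons mulrA.
under [X in _ + X + _]eq_bigr do rewrite set_factor_wcons0 c_tens_wcons mulrA.
rewrite -!mulr_suml -mulrDl c_inv mul0r add0r.
under eq_bigr do under eq_bigr do rewrite wconsS set_factor_wconsS c_tens_wcons mulrCA.
under eq_bigr do rewrite -mulr_sumr.
rewrite -mulr_sumr; have := tI X K; rewrite ffunE => ->.
by rewrite mulr0.
Qed.

Lemma hword_wcons m : hword m.+1 = wcons sl_h (hword m).
Proof. by apply/ffunP=> i; rewrite !ffunE; case: unlift => // j; rewrite ffunE. Qed.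

Lemma c_tens_hword t : c_tens t (hword n.+2) = 2^-1 * t (hword n).
Proof. by rewrite !hword_wcons c_tens_wcons. Qed.

End Products.

Lemma Inv_even_hword n : ~~ odd n -> exists2 t : tens n, t \in Inv n & t (hword n) != 0.
Proof.
move=> n_even; rewrite -(odd_double_half n) (negPf n_even) add0n.
elim: (n./2) => [|m [t tI t0]].
  by exists [ffun=> 1]; [apply/InvP=> X I; rewrite ffunE big_ord0 | rewrite ffunE].
exists (c_tens t); first exact: c_tens_Inv.
by rewrite c_tens_hword mulf_neq0.
Qed.

(** The bracket grafted on one factor of c is b, as kappa and c are inverse to
    each other. *)
Lemma graft_c_tens n (t : tens n) a b c K :
  graft_tens (c_tens t) (wcons a (wcons b (wcons c K))) = b_coef a b c * t K.
Proof.
rewrite graft_tens_wcons; under eq_bigr do rewrite c_tens_wcons mulrA.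
rewrite -mulr_suml; congr (_ * _); rewrite /graft_coef.
under eq_bigr do rewrite mulr_suml.
rewrite exchange_big /=; under eq_bigr do under eq_bigr do rewrite -mulrA.
under eq_bigr do rewrite -mulr_sumr kappa_cK.
by rewrite (bigD1 c) //= eqxx mulr1 big1 ?addr0 // => z /negPf->; rewrite mulr0.
Qed.

Definition slot2 n : 'I_n.+3 := lift ord0 (lift ord0 ord0).
Definition slot3 n : 'I_n.+4 := lift ord0 (lift ord0 (lift ord0 ord0)).

Lemma perm02_wcons n a b c (K : word n) :
  [ffun j => wcons a (wcons b (wcons c K)) (tperm ord0 (slot2 n) j)] =
  wcons c (wcons b (wcons a K)).
Proof.
apply/ffunP=> i; rewrite ffunE.
case: (unliftP ord0 i) => [i1 ->|->]; last by rewrite tpermL !wconsS !wcons0.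
case: (unliftP ord0 i1) => [i2 ->|->]; last by rewrite tpermD // !wconsS !wcons0.
case: (unliftP ord0 i2) => [i3 ->|->]; last by rewrite tpermR !wconsS !wcons0.
by rewrite tpermD ?(inj_eq lift_inj) // !wconsS.
Qed.

Lemma graft_c_tens_antisym n (t : tens n) :
  tens_act (tperm ord0 (slot2 n)) (graft_tens (c_tens t)) = - graft_tens (c_tens t).
Proof.
apply/ffunP=> I; rewrite (wcons_eta I) (wcons_eta (wtail I)) (wcons_eta (wtail (wtail I))).
move: (I _) (wtail I _) (wtail (wtail I) _) (wtail (wtail (wtail I))) => a b c K.
rewrite tens_actE !ffunE perm02_wcons !graft_c_tens -mulNr; congr (_ * _).
by case: a; case: b; case: c.
Qed.

Lemma perm_wcons n a (K : word n) i j :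
  [ffun k => wcons a K (tperm (lift ord0 i) (lift ord0 j) k)] =
  wcons a [ffun k => K (tperm i j k)].
Proof.
apply/ffunP=> k; rewrite ffunE; case: (unliftP ord0 k) => [k' ->|->].
  by rewrite -(inj_tperm _ _ _ (@lift_inj _ ord0)) !wconsS ffunE.
by rewrite tpermD ?wcons0 // eq_sym neq_lift.
Qed.

Lemma graft_tens_tperm n (t : tens n.+1) (i j : 'I_n) :
  graft_tens (tens_act (tperm (lift ord0 i) (lift ord0 j)) t) =
  tens_act (tperm (lift ord0 (lift ord0 i)) (lift ord0 (lift ord0 j))) (graft_tens t).
Proof.
apply/ffunP=> I; rewrite (wcons_eta I) (wcons_eta (wtail I)).
move: (I _) (wtail I _) (wtail (wtail I)) => a b K.
rewrite graft_tens_wcons.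
rewrite [RHS](_ : _ = graft_tens t (wcons a (wcons b [ffun k => K (tperm i j k)]))).
  rewrite graft_tens_wcons; apply: eq_bigr => y _; congr (_ * _).
  by rewrite tens_actE ffunE perm_wcons.
by rewrite tens_actE ffunE !perm_wcons.
Qed.

(** Let g be this graft.  It changes sign under (0 2), and it is fixed by (2 3)
    modulo L, as the graft of c_tens t - (1 2) c_tens t, where phi vanishes, is
    in L.  Now (0 3) is conjugate to (2 3) by (0 2), and (0 2) to (2 3) by
    (0 3): both fix g modulo L, the two signs cancelling for (0 3).  So g = - g
    modulo L. *)
Lemma graft_c_tens_sub n (t : tens n.+1) (L : {vspace tens n.+4}) :
  (forall s u, u \in L -> tens_act s u \in L) ->
  (forall u, u \in Inv n.+3 -> u (hword _) = 0 -> graft_tens u \in L) ->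
  t \in Inv n.+1 -> graft_tens (c_tens t) \in L.
Proof.
move=> Lact Lgraft tI; set g := graft_tens (c_tens t).
pose s02 : 'S_n.+4 := tperm ord0 (slot2 _); pose s23 : 'S_n.+4 := tperm (slot2 _) (slot3 _).
pose s03 : 'S_n.+4 := tperm ord0 (slot3 _).
have A02 : tens_act s02 g = - g by exact: graft_c_tens_antisym.
have cI := c_tens_Inv tI.
have A23 : tens_act s23 g - g \in L.
  rewrite /s23 -graft_tens_tperm -linearB /=; apply: Lgraft.
    by apply: rpredB => //; apply: tens_act_Inv.
  by rewrite ffunE [X in _ + X]ffunE tens_act_hword subrr.
have e03 : s03 = (s02 * s23 * s02)%g.
  rewrite -[X in (X * _ * _)%g]tpermV -mulgA -conjgE tpermJ tpermR tpermD //.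
have e02 : s02 = (s03 * s23 * s03)%g.
  rewrite -[X in (X * _ * _)%g]tpermV -mulgA -conjgE tpermJ tpermR tpermD // tpermC //.
have A03 : tens_act s03 g - g \in L.
  rewrite e03 !tens_actMv A02 !linearN /=.
  rewrite -[X in _ - X]opprK -A02 -opprD -linearB rpredN; exact: Lact.
have : tens_act s02 g - g \in L.
  rewrite e02 !tens_actMv.
  set A := tens_act s03; set C := tens_act s23.
  have -> : A (C (A g)) - g = A (C (A g - g)) + (A (C g - g) + (A g - g)).
    by rewrite !linearB /= addrA !addrA !subrK.
  by apply: memvD; [do 2!apply: (Lact) | apply: memvD => //; apply: Lact].
rewrite A02 -opprD rpredN -mulr2n -scaler_nat => gL.
by have := memvZ (2^-1 : rat) gL; rewrite scalerA mulVf // scale1r.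
Qed.

Lemma Inv1_eq0 (t : tens 1) : t \in Inv 1 -> t = 0.
Proof.
move=> tI; apply: symmetric_Inv_eq0 => // [s|]; last exact: Inv_odd_hword.
suff -> : s = 1%g by rewrite tens_act1 id_lfunE.
by apply/permP=> i; rewrite !ord1.
Qed.

(** By [Inv_graft_sub] it is enough to reach the grafts of invariants with one
    factor less: there are none for m = 0, and otherwise the induction hypothesis
    leaves out at most one dimension, represented by q. *)
Lemma Inv_hword_limg m (t : tens m.+2) :
  t \in Inv m.+2 -> t (hword _) = 0 -> t \in limg (Wh m.+2).
Proof.
elim: m t => [|m IH] t; apply: Inv_graft_sub => {t} [s t|t]; try exact: limg_stable.
  by move/Inv1_eq0->; rewrite linear0 mem0v.
move=> tI; have [m_odd|m_even] := boolP (odd m).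
  by apply/graft_limg/IH/Inv_odd_hword; rewrite //= negbK.
have [q [qI q0 qL]] : exists q, [/\ q \in Inv m.+2, q (hword _) != 0
    & graft_tens q \in limg (Wh m.+3)].
  case: m m_even IH {t tI} => [|[//|m]] m_even IH.
    exists (W_tree strut); rewrite W_tree_Inv W_strut_hword; split=> //.
    exact/graft_limg/W_tree_limg.
  have [q qI q0] := @Inv_even_hword m.+2 m_even.
  exists (c_tens q); rewrite c_tens_Inv // c_tens_hword mulf_neq0 //; split=> //.
  apply: graft_c_tens_sub => // [s u|u uI u0]; first exact: limg_stable.
  exact/graft_limg/IH.
(* Subtracting a multiple of q brings t into the induction hypothesis. *)
pose a : rat := t (hword _) / q (hword _).
rewrite -(subrK (a *: q) t) linearD; apply: memvD; last by rewrite linearZ; apply: memvZ.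
apply/graft_limg/IH; first by rewrite rpredB ?memvZ.
by rewrite !ffunE -[a *: _]/(a * _) divfK ?subrr.
Qed.

(** * Characters along exact sequences *)

Section Trace.
Variables (K : fieldType) (V : vectType K).

(** The trace does not depend on the basis: expand the vectors of X in Y, then
    the images of the vectors of Y in X. *)
Lemma trace_basis n m (X : n.-tuple V) (Y : m.-tuple V) (U : {vspace V}) (f : 'End(V)) :
  basis_of U X -> basis_of U Y -> (forall v, v \in U -> f v \in U) ->
  \sum_(i < n) coord X i (f X`_i) = \sum_(j < m) coord Y j (f Y`_j).
Proof.
move=> bX bY fU.
have X_U (i : 'I_n) : X`_i \in U by apply: basis_mem bX _; rewrite mem_nth ?size_tuple.
have Y_U (i : 'I_m) : Y`_i \in U by apply: basis_mem bY _; rewrite mem_nth ?size_tuple.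
transitivity (\sum_(i < n) \sum_(j < m) coord Y j X`_i * coord X i (f Y`_j)).
  apply: eq_bigr => i _; rewrite {1}[X`_i](coord_basis bY) // linear_sum linear_sum /=.
  by apply: eq_bigr => j _; rewrite !linearZ.
rewrite exchange_big; apply: eq_bigr => j _ /=.
rewrite [f Y`_j in RHS](coord_basis bX) ?fU // linear_sum /=.
by apply: eq_bigr => i _; rewrite linearZ mulrC.
Qed.

End Trace.

Lemma chi_basis (gT : finGroupType) (K : fieldType) (V : vectType K) (a : gT -> 'End(V))
    (U : {vspace V}) g n (X : n.-tuple V) : basis_of U X ->
  (forall v, v \in U -> a g v \in U) -> chi a U g = \sum_(i < n) coord X i (a g X`_i).
Proof.
move=> bX aU; rewrite -(trace_basis (vbasisP U) bX aU).
by apply: eq_bigr => i _; rewrite mxE.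
Qed.

(** A basis of the kernel, completed by preimages of a basis of the image, is a
    basis of U in which the action is block triangular. *)
Lemma chi_exact (gT : finGroupType) (K : fieldType) (V W : vectType K)
    (aV : gT -> 'End(V)) (aW : gT -> 'End(W)) (f : 'Hom(V, W)) (U : {vspace V}) g :
  (forall v, v \in U -> aV g v \in U) -> (forall v, f (aV g v) = aW g (f v)) ->
  chi aV U g = chi aV (U :&: lker f)%VS g + chi aW (f @: U)%VS g.
Proof.
move=> aU fa; set N := (U :&: lker f)%VS; set I := (f @: U)%VS.
have aN v : v \in N -> aV g v \in N.
  rewrite !memv_cap !memv_ker => /andP[vU /eqP fv].
  by rewrite aU // fa fv linear0 eqxx.
have aI w : w \in I -> aW g w \in I.
  by move=> /memv_imgP[v vU ->]; rewrite -fa memv_img // aU.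
pose X := vbasis N; pose Z := vbasis I.
have X_N (i : 'I_(\dim N)) : X`_i \in N by apply: vbasis_mem; rewrite mem_nth ?size_tuple.
have /fin_all_exists2[y yU fy] : forall j : 'I_(\dim I), exists2 v, v \in U & f v = Z`_j.
  move=> j; have /memv_imgP[v vU ->] : Z`_j \in I.
    by apply: vbasis_mem; rewrite mem_nth ?size_tuple.
  by exists v.
pose Y := [tuple y j | j < \dim I].
have YE (j : 'I_(\dim I)) : Y`_j = y j by rewrite -tnth_nth tnth_mktuple.
pose XY := [tuple of X ++ Y].
have XYl (i : 'I_(\dim N)) : XY`_(lshift (\dim I) i) = X`_i.
  by rewrite nth_cat size_tuple /= ltn_ord.
have XYr (j : 'I_(\dim I)) : XY`_(rshift (\dim N) j) = Y`_j.
  by rewrite nth_cat size_tuple /= ltnNge leq_addr /= addKn.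
have split v : v \in U -> v = \sum_i coord X i (v - \sum_j coord Z j (f v) *: y j) *: X`_i
     + \sum_j coord Z j (f v) *: y j.
  move=> vU; rewrite -coord_vbasis ?subrK // memv_cap; apply/andP; split.
    by apply: memvB => //; apply: memv_suml => j _; apply: memvZ.
  rewrite memv_ker linearB /= linear_sum.
  under eq_bigr do rewrite linearZ /= fy.
  by rewrite -coord_vbasis ?memv_img // subrr.
have bXY : basis_of U XY.
  rewrite basisEdim size_tuple; apply/andP; split; last by rewrite limg_ker_dim.
  apply/subvP=> v /split->; apply: memvD; apply: memv_suml => i _; apply: memvZ.
    by rewrite -XYl memv_span ?mem_nth ?size_tuple.
  by rewrite -YE -XYr memv_span ?mem_nth ?size_tuple.
have fX (i : 'I_(\dim N)) : f X`_i = 0.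
  by have := X_N i; rewrite memv_cap memv_ker => /andP[_ /eqP].
have decomp v : v \in U -> v = \sum_(i < \dim N) coord XY (lshift (\dim I) i) v *: X`_i
    + \sum_(j < \dim I) coord XY (rshift (\dim N) j) v *: y j.
  move=> vU; rewrite {1}[v](coord_basis bXY) // big_split_ord /=.
  congr (_ + _); apply: eq_bigr => i _; first by rewrite XYl.
  by rewrite XYr YE.
have cr v j : v \in U -> coord XY (rshift (\dim N) j) v = coord Z j (f v).
  move=> vU; rewrite {2}(decomp v vU) linearD /= !linear_sum.
  rewrite [X in coord _ _ (X + _)]big1 => [|i _]; last by rewrite linearZ /= fX scaler0.
  rewrite add0r; under [in RHS]eq_bigr do rewrite linearZ /= fy.
  by rewrite coord_sum_free // (basis_free (vbasisP _)).
have cl v i : v \in N -> coord XY (lshift (\dim I) i) v = coord X i v.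
  move=> vN; have vU : v \in U by move: vN; rewrite memv_cap => /andP[].
  rewrite {2}(decomp v vU) [rest in coord X i (_ + rest)]big1 => [|j _]; last first.
    rewrite cr //; move: vN; rewrite memv_cap memv_ker => /andP[_ /eqP ->].
    by rewrite linear0 scale0r.
  by rewrite addr0 coord_sum_free // (basis_free (vbasisP _)).
rewrite (chi_basis bXY) // (chi_basis (vbasisP N)) // (chi_basis (vbasisP I)) //.
rewrite big_split_ord /=; congr (_ + _); apply: eq_bigr => i _.
  by rewrite XYl cl // aN.
by rewrite XYr YE cr ?aU // fa fy.
Qed.

Definition hcoef n : 'Hom(tens n, rat^o) := linfun (fun t : tens n => t (hword n) : rat^o).

Lemma hcoefE n (t : tens n) : hcoef n t = t (hword n).
Proof. by apply: linfun_linearE => a u v; rewrite !ffunE. Qed.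

(** For n odd no invariant has a coefficient at h (x) ... (x) h; for n = 2 the
    strut has one, and accounts for the remaining dimension. *)
Lemma limg_Wh_eq_Inv n : n = 2%N \/ (2 < n)%N /\ odd n -> limg (Wh n) = Inv n.
Proof.
case: n => [|[|m]] hn; try by [case: hn => [|[]]].
apply/eqP; rewrite eqEsubv limg_Wh_Inv; apply/subvP=> t tI.
case: hn => [[m0]|[_ /= m_odd]]; last first.
  by apply: Inv_hword_limg => //; apply: Inv_odd_hword.
move: t tI; rewrite m0 => t tI.
pose a : rat := t (hword _) / W_tree strut (hword _).
rewrite -(subrK (a *: W_tree strut) t); apply: memvD; last by rewrite memvZ ?W_tree_limg.
apply: Inv_hword_limg; first by rewrite rpredB ?memvZ ?W_tree_Inv.
rewrite ffunE [X in _ + X]ffunE [X in - X]ffunE -[a *: _]/(a * _).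
by rewrite divfK ?subrr ?W_strut_hword.
Qed.

Lemma limg_Wh_even n : (4 <= n)%N -> limg (Wh n) = (Inv n :&: lker (hcoef n))%VS.
Proof.
case: n => [|[|m]] // n4; apply/eqP; rewrite eqEsubv subv_cap limg_Wh_Inv /=.
apply/andP; split.
  apply: limg_Wh_sub => T; rewrite memv_ker hcoefE W_tree_h0 //; lia.
apply/subvP=> t; rewrite memv_cap memv_ker hcoefE => /andP[tI /eqP t0].
exact: Inv_hword_limg.
Qed.

Lemma hcoef_Inv_even n : ~~ odd n -> (hcoef n @: Inv n)%VS = fullv.
Proof.
move=> n_even; have [q qI q0] := Inv_even_hword n_even.
apply/eqP; rewrite eqEsubv subvf; apply/subvP=> r _; apply/memv_imgP.
exists ((r / q (hword n) : rat) *: q); first exact: memvZ.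
by rewrite linearZ /= hcoefE /GRing.scale /= divfK.
Qed.

Theorem corollary1p3 (n : nat) (hn : (2 <= n)%N) :
  [/\ forall T : tree n, Wh n (tree_class T) = W_tree T,
      (limg (Wh n) <= Inv n)%VS
    & forall (s : 'S_n) (x : Cn n), Wh n (Cn_act s x) = tens_act s (Wh n x)]
  /\ (n = 2%N \/ (2 < n)%N /\ odd n -> forall s : 'S_n,
        chi (@Cn_act n) (lker (Wh n)) s
          = chi (@Cn_act n) fullv s - chi (@tens_act n) (Inv n) s
        /\ chi (@tens_act n) (limg (Wh n)) s = chi (@tens_act n) (Inv n) s)
  /\ ((4 <= n)%N /\ ~~ odd n -> forall s : 'S_n,
        chi (@Cn_act n) (lker (Wh n)) s
          = chi (@Cn_act n) fullv s - chi (@tens_act n) (Inv n) s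
            + chi (@trivial_act 'S_n rat) fullv s
        /\ chi (@tens_act n) (limg (Wh n)) s
          = chi (@tens_act n) (Inv n) s - chi (@trivial_act 'S_n rat) fullv s).
Proof.
have chiC s : chi (@Cn_act n) fullv s =
    chi (@Cn_act n) (lker (Wh n)) s + chi (@tens_act n) (limg (Wh n)) s.
  rewrite (chi_exact (aW := @tens_act n) (f := Wh n)) ?capfv // => [v _|].
    exact: memvf.
  exact: Wh_equiv.
split; last split.
- by split; [exact: Wh_class | exact: limg_Wh_Inv | exact: Wh_equiv].
- by move=> nP s; rewrite chiC limg_Wh_eq_Inv // addrK.
- move=> [n4 n_even] s.
  have chiI : chi (@tens_act n) (Inv n) s =
      chi (@tens_act n) (limg (Wh n)) s + chi (@trivial_act 'S_n rat) fullv s.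
    rewrite (chi_exact (aW := @trivial_act 'S_n rat) (f := hcoef n)) => [|v vI|v].
    + by rewrite hcoef_Inv_even // limg_Wh_even.
    + exact: tens_act_Inv.
    + by rewrite id_lfunE !hcoefE tens_act_hword.
  by rewrite chiC chiI opprD addrA addrK subrK addrK.
Qed.
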